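(* Let $(M,g)$ be a Riemannian manifold and let $\widetilde\gamma$ be a geodesic on $T^p_q(M)$ with respect to the Levi-Civita connection $\widehat\nabla$ of the rescaled Sasaki type metric ${}^Sg_f$, locally given by $x^r=x^r(t)$, $t^{v_1\dots v_p}_{r_1\dots r_q}=t^{v_1\dots v_p}_{r_1\dots r_q}(t)$, and let $\gamma=\pi\circ\widetilde\gamma$. Then the tensor field $t^{v_1\dots v_p}_{r_1\dots r_q}(t)$ along $\gamma$ satisfies the differential equations $$\frac{\delta^2x^r}{dt^2}+\frac1{2f}{}^fA_{lj}^r\frac{dx^l}{dt}\frac{dx^j}{dt}+\frac1f g_{c_1k_1}\cdots g_{c_pk_p}g^{l_1h_1}\cdots g^{l_qh_q}\Big(\sum_{\mu=1}^qR^{r}{}_{jh_\mu}{}^{s}\,t^{k_1\dots k_p}_{h_1\dots s\dots h_q}-\sum_{\lambda=1}^pR^{r}{}_{js}{}^{k_\lambda}\,t^{k_1\dots s\dots k_p}_{h_1\dots h_q}\Big)\frac{\delta t^{c_1\dots c_p}_{l_1\dots l_q}}{dt}\frac{dx^j}{dt}=0$$ and has vanishing second covariant derivative: $\dfrac{\delta^2t^{v_1\dots v_p}_{r_1\dots r_q}}{dt^2}=0$.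
   Context: All objects are smooth; Einstein summation. $f>0$ is a smooth function on $M$. $\nabla$ is the Levi-Civita connection of $g$ with Christoffel symbols $\Gamma_{ij}^h$; $R(X,Y)=[\nabla_X,\nabla_Y]-\nabla_{[X,Y]}$, $R(\partial_k,\partial_l)\partial_j=R_{klj}{}^{s}\partial_s$, $R^{r}{}_{jh}{}^{s}=g^{xr}R_{xjh}{}^s$. ${}^fA_{ji}^h=f_j\delta_i^h+f_i\delta_j^h-f^hg_{ji}$, $f_i=\partial_if$, $f^h=g^{hm}f_m$. $\delta/dt$ is the covariant derivative along $\gamma$ with respect to $\nabla$ (so $\delta^2x^r/dt^2=\ddot x^r+\Gamma^r_{lj}\dot x^l\dot x^j$); $t$ as a parameter is proportional to arc length (affine parameter). In the sums, $s$ stands in the $\mu$-th lower, respectively $\lambda$-th upper, position. $\pi:T^p_q(M)\to M$ is the bundle of tensors of type $(p,q)$ ($p$ contravariant, $q$ covariant indices), with induced coordinates $(x^j,t^{i_1\dots i_p}_{j_1\dots j_q})$. The vertical lift of a $(p,q)$-tensor field $A$ is ${}^VA=A^{i_1\dots i_p}_{j_1\dots j_q}\partial/\partial t^{i_1\dots i_p}_{j_1\dots j_q}$; the horizontal lift of a vector field $X$ is $${}^HX=X^j\frac{\partial}{\partial x^j}+X^s\Big(\sum_{\mu=1}^q\Gamma_{sj_\mu}^mt^{i_1\dots i_p}_{j_1\dots m\dots j_q}-\sum_{\lambda=1}^p\Gamma_{sm}^{i_\lambda}t^{i_1\dots m\dots i_p}_{j_1\dots j_q}\Big)\frac{\partial}{\partial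 t^{i_1\dots i_p}_{j_1\dots j_q}}.$$ The metric ${}^Sg_f$ on $T^p_q(M)$ is defined by ${}^Sg_f({}^VA,{}^VB)=g_{i_1c_1}\cdots g_{i_pc_p}g^{j_1l_1}\cdots g^{j_ql_q}A^{i_1\dots i_p}_{j_1\dots j_q}B^{c_1\dots c_p}_{l_1\dots l_q}$, ${}^Sg_f({}^VA,{}^HY)=0$, ${}^Sg_f({}^HX,{}^HY)=f\,g(X,Y)$. *)

(* Defs.v *)
From HB Require Import structures.
From mathcomp Require Import all_boot all_order all_algebra.
From mathcomp Require Import ring.
From mathcomp Require Import all_classical all_reals all_analysis.
Set Implicit Arguments.
Unset Strict Implicit.
Unset Printing Implicit Defensive.
Import Order.TTheory GRing.Theory Num.Theory.
Import numFieldNormedType.Exports.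
Local Open Scope classical_set_scope.
Local Open Scope ring_scope.

(** Points of R^N are row vectors ['rV[R]_N]. *)

Section LocalCalculus.
Context {R : realType} {N : nat}.
Implicit Types (U : set 'rV[R]_N) (F : 'rV[R]_N -> R).

Definition partial (i : 'I_N) F (x : 'rV[R]_N) : R := 'D_(delta_mx 0 i) F x.

(** C^k on an open set [U]. *)
Fixpoint Ck (k : nat) U F : Prop :=
  match k with
  | 0 => forall x, U x -> {for x, continuous F}
  | k'.+1 => (forall x, U x -> differentiable F x) /\
             (forall i, Ck k' U (partial i F))
  end.

Definition smooth_on U F : Prop := forall k, Ck k U F.

Definition smooth_curve_on (T : set R) (c : R -> 'rV[R]_N) : Prop :=
  forall (k : nat) (a : 'I_N) (t : R), T t ->
    derivable (derive1n k (fun s => c s 0 a)) t 1.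

Definition velocity (c : R -> 'rV[R]_N) (t : R) (a : 'I_N) : R :=
  derive1 (fun s => c s 0 a) t.

(** Coordinate expressions of a metric [G], with [G x i j] = g_ij(x) and
    [invmx (G x) i j] = g^ij(x). *)

Definition christoffel (G : 'rV[R]_N -> 'M[R]_N) (x : 'rV[R]_N)
    (h i j : 'I_N) : R :=
  2^-1 * \sum_m invmx (G x) h m *
    (partial i (fun y => G y m j) x + partial j (fun y => G y m i) x
     - partial m (fun y => G y i j) x).

(** The Christoffel symbols are those of the torsion-free metric connection. *)
Lemma christoffel_levi_civita (G : 'rV[R]_N -> 'M[R]_N) (x : 'rV[R]_N) :
  G x \in unitmx -> (\forall y \near x, (G y)^T = G y) ->
  (forall h i j, christoffel G x h i j = christoffel G x h j i) /\
  (forall i j k, partial i (fun y => G y j k) x =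
     \sum_m (christoffel G x m i j * G x m k + christoffel G x m i k * G x j m)).
Proof.
move=> Gu Gs.
have sym i a b : partial i (fun y => G y a b) x = partial i (fun y => G y b a) x.
  by apply: near_eq_derive; near=> y; rewrite -[in LHS](near Gs y _) ?mxE.
have Gsx : forall a b, G x a b = G x b a.
  by move=> a b; rewrite -[in LHS](nbhs_singleton Gs) mxE.
have low i j k : \sum_m christoffel G x m i j * G x k m = 2^-1 *
    (partial i (fun y => G y k j) x + partial j (fun y => G y k i) x
     - partial k (fun y => G y i j) x).
  pose v : 'cV[R]_N := \col_m (partial i (fun y => G y m j) x +
    partial j (fun y => G y m i) x - partial m (fun y => G y i j) x).
  transitivity (2^-1 * (G x *m (invmx (G x) *m v)) k 0); last first.
    by rewrite mulmxA mulmxV // mul1mx mxE.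
  rewrite mxE mulr_sumr; apply: eq_bigr => m _.
  rewrite /christoffel -mulrA; congr (_ * _).
  by rewrite mulrC mxE; congr (_ * _); apply: eq_bigr => l _; rewrite mxE.
split=> [h i j|i j k].
  rewrite /christoffel; congr (_ * _); apply: eq_bigr => m _.
  by rewrite [partial m (fun y => G y i j) x]sym [X in X - _]addrC.
rewrite big_split /=; under eq_bigr do rewrite Gsx.
rewrite !low -mulrDr (sym j k i) (sym k i j) (sym i k j) (sym k j i) (sym j i k).
by field.
Unshelve. all: by end_near. Qed.

(** The components of delta^2 c / dt^2, i.e. of the covariant derivative of
    the velocity along [c]. *)
Definition acceleration (G : 'rV[R]_N -> 'M[R]_N) (c : R -> 'rV[R]_N)
    (t : R) (h : 'I_N) : R :=
  derive1n 2%N (fun s => c s 0 h) t +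
  \sum_i \sum_j christoffel G (c t) h i j * velocity c t i * velocity c t j.

(** [riemann G x k l j s] = R_{klj}^s, where
    R(X,Y) = [nabla_X, nabla_Y] - nabla_[X,Y] and
    R(d_k, d_l) d_j = R_{klj}^s d_s. *)
Definition riemann (G : 'rV[R]_N -> 'M[R]_N) (x : 'rV[R]_N)
    (k l j s : 'I_N) : R :=
  partial k (fun y => christoffel G y s l j) x
  - partial l (fun y => christoffel G y s k j) x
  + \sum_m (christoffel G x s k m * christoffel G x m l j
            - christoffel G x s l m * christoffel G x m k j).

(** [riemann_up G x r j h s] = R^r_{jh}^s = g^{ar} R_{ajh}^s. *)
Definition riemann_up (G : 'rV[R]_N -> 'M[R]_N) (x : 'rV[R]_N)
    (r j h s : 'I_N) : R :=
  \sum_a invmx (G x) a r * riemann G x a j h s.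

(** [fA G f x h j i] = f_j delta^h_i + f_i delta^h_j - f^h g_ji. *)
Definition fA (G : 'rV[R]_N -> 'M[R]_N) (f : 'rV[R]_N -> R) (x : 'rV[R]_N)
    (h j i : 'I_N) : R :=
  partial j f x * (h == i)%:R + partial i f x * (h == j)%:R
  - (\sum_m invmx (G x) h m * partial m f x) * G x j i.

End LocalCalculus.

Section Manifolds.
Variable R : realType.

Record chart (M : topologicalType) (n : nat) := Chart {
  chart_dom : set M;
  chart_coord : M -> 'rV[R]_n;
  chart_inv : 'rV[R]_n -> M;
  chart_dom_open : open chart_dom;
  chart_image_open : open (chart_coord @` chart_dom);
  chart_coordK : forall m, chart_dom m -> chart_inv (chart_coord m) = m;
  chart_coord_cont : forall m, chart_dom m -> {for m, continuous chart_coord};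
  chart_inv_cont : forall x, (chart_coord @` chart_dom) x ->
    {for x, continuous chart_inv}
}.

Definition transition (M : topologicalType) (n : nat) (phi psi : chart M n)
  (x : 'rV[R]_n) : 'rV[R]_n := chart_coord psi (chart_inv phi x).

Definition overlap (M : topologicalType) (n : nat) (phi psi : chart M n) :
  set 'rV[R]_n := chart_coord phi @` (chart_dom phi `&` chart_dom psi).

Record manifold (n : nat) := Manifold {
  carrier :> topologicalType;
  chart_index : Type;
  atlas : chart_index -> chart carrier n;
  hausdorff : hausdorff_space carrier;
  countable_basis : @second_countable carrier;
  atlas_cover : forall m, exists i, chart_dom (atlas i) m;
  atlas_smooth : forall i j (a : 'I_n),
    smooth_on (overlap (atlas i) (atlas j))
      (fun x => transition (atlas i) (atlas j) x 0 a)
}.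

Definition chart_image n (M : manifold n) (i : chart_index M) :
  set 'rV[R]_n := chart_coord (atlas i) @` chart_dom (atlas i).

(** [jac i j x a b] = d x'^a / d x^b, for x the coordinates of chart [i] and
    x' those of chart [j]. *)
Definition jac n (M : manifold n) (i j : chart_index M)
  (x : 'rV[R]_n) : 'M[R]_n :=
  \matrix_(a, b) partial b (fun y => transition (atlas i) (atlas j) y 0 a) x.

Definition local_fun n (M : manifold n) (f : M -> R) (i : chart_index M)
  (x : 'rV[R]_n) : R := f (chart_inv (atlas i) x).

Definition smooth_fun n (M : manifold n) (f : M -> R) : Prop :=
  forall i : chart_index M, smooth_on (chart_image i) (local_fun f i).

Record riemannian_metric n (M : manifold n) := RiemannianMetric {
  metric :> chart_index M -> 'rV[R]_n -> 'M[R]_n;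
  metric_smooth : forall i a b,
    smooth_on (chart_image i) (fun x => metric i x a b);
  metric_sym : forall i x, chart_image i x -> (metric i x)^T = metric i x;
  metric_pos : forall i x (v : 'rV[R]_n), chart_image i x -> v != 0 ->
    0 < (v *m metric i x *m v^T) 0 0;
  metric_change : forall i j x, overlap (atlas i) (atlas j) x ->
    metric i x =
    (jac i j x)^T *m metric j (transition (atlas i) (atlas j) x) *m jac i j x
}.

End Manifolds.

(** [(u, l) : multi n p q] stands for the upper indices u_1 ... u_p and the
    lower indices l_1 ... l_q. *)
Definition multi (n p q : nat) : finType :=
  ({ffun 'I_p -> 'I_n} * {ffun 'I_q -> 'I_n})%type.

(** u_1 ... m ... u_p, with m in the position [k]. *)
Definition subst_index (n p : nat) (u : {ffun 'I_p -> 'I_n}) (k : 'I_p)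
  (m : 'I_n) : {ffun 'I_p -> 'I_n} := [ffun k' => if k' == k then m else u k'].

Section Tensors.
Variables (R : realType) (n p q : nat).

(** Component arrays of (p,q)-tensors, flattened to row vectors so that they
    can serve as the fibre coordinates of the tensor bundle. *)
Definition tensor := 'rV[R]_#|multi n p q|.

Definition tcomp (t : tensor) (u : {ffun 'I_p -> 'I_n})
  (l : {ffun 'I_q -> 'I_n}) : R := t 0 (enum_rank ((u, l) : multi n p q)).

Definition mk_tensor (F : {ffun 'I_p -> 'I_n} -> {ffun 'I_q -> 'I_n} -> R) :
  tensor := \row_k F (enum_val k).1 (enum_val k).2.

(** [J a b] = d x'^a / d x^b, [J' b a] = d x^b / d x'^a. *)
Definition tensor_change (J J' : 'M[R]_n) (t : tensor) : tensor :=
  mk_tensor (fun u' l' =>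
    \sum_(u : {ffun 'I_p -> 'I_n}) \sum_(l : {ffun 'I_q -> 'I_n})
    (\prod_(k < p) J (u' k) (u k)) * (\prod_(k < q) J' (l k) (l' k)) *
    tcomp t u l).

(** [lower_prod g c k] = g_{c_1 k_1} ... g_{c_r k_r}; with the inverse matrix
    for [g] this is g^{c_1 k_1} ... g^{c_r k_r}. *)
Definition lower_prod (r : nat) (g : 'M[R]_n) (c k : {ffun 'I_r -> 'I_n}) : R :=
  \prod_(m < r) g (c m) (k m).

Definition fibre_product (g : 'M[R]_n) (A B : tensor) : R :=
  \sum_(i : {ffun 'I_p -> 'I_n}) \sum_(c : {ffun 'I_p -> 'I_n})
  \sum_(j : {ffun 'I_q -> 'I_n}) \sum_(l : {ffun 'I_q -> 'I_n})
    lower_prod g i c * lower_prod (invmx g) j l * tcomp A i j * tcomp B c l.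

(** Lifts in the induced coordinates [row_mx x t] of the tensor bundle. *)

Definition vertical_lift (A : tensor) : 'rV[R]_(n + #|multi n p q|) :=
  row_mx 0 A.

Definition horizontal_lift (G : 'rV[R]_n -> 'M[R]_n) (x : 'rV[R]_n)
    (t : tensor) (X : 'rV[R]_n) : 'rV[R]_(n + #|multi n p q|) :=
  row_mx X (mk_tensor (fun i j => \sum_s X 0 s *
    (\sum_(mu < q) \sum_m
       christoffel G x m s (j mu) * tcomp t i (subst_index j mu m)
     - \sum_(la < p) \sum_m
       christoffel G x (i la) s m * tcomp t (subst_index i la m) j))).

(** delta t / dt along the curve [x]. *)
Definition cov_deriv (G : 'rV[R]_n -> 'M[R]_n) (x : R -> 'rV[R]_n)
    (t : R -> tensor) (s : R) : tensor :=
  mk_tensor (fun i j =>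
    derive1 (fun s' => tcomp (t s') i j) s +
    \sum_l velocity x s l *
    (\sum_(la < p) \sum_m
       christoffel G (x s) (i la) l m * tcomp (t s) (subst_index i la m) j
     - \sum_(mu < q) \sum_m
       christoffel G (x s) m l (j mu) * tcomp (t s) i (subst_index j mu m))).

End Tensors.

Section TensorBundle.
Variables (R : realType) (n : nat) (M : manifold R n) (p q : nat).

(** A point of T^p_q(M): a point of M and a (p,q)-tensor there, given by its
    components in all the charts around the point. Setting the entries for the
    other charts to zero makes the representation unique. *)
Record tensor_bundle := TensorBundle {
  base : M;
  components : chart_index M -> tensor R n p q;
  components_out : forall i, ~ chart_dom (atlas i) base -> components i = 0;
  components_change : forall i j,
    chart_dom (atlas i) base -> chart_dom (atlas j) base ->
    components j =
    tensor_change (jac i j (chart_coord (atlas i) base))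
                  (jac j i (chart_coord (atlas j) base)) (components i)
}.

(** The components, in every induced chart, of the metric on T^p_q(M) with the
    prescribed values on the vertical and horizontal lifts. As lifts at a point
    depend only on the values of the fields there, [A], [B], [X], [Y] are
    those values. *)
Record is_rescaled_sasaki (g : riemannian_metric M) (f : M -> R)
    (Sg : chart_index M -> 'rV[R]_(n + #|multi n p q|) ->
          'M[R]_(n + #|multi n p q|)) : Prop := IsRescaledSasaki {
  sasaki_sym : forall i x (t : tensor R n p q), chart_image i x ->
    (Sg i (row_mx x t))^T = Sg i (row_mx x t);
  sasaki_VV : forall i x (t A B : tensor R n p q), chart_image i x ->
    (vertical_lift A *m Sg i (row_mx x t) *m (vertical_lift B)^T) 0 0 =
    fibre_product (g i x) A B;
  sasaki_VH : forall i x (t A : tensor R n p q) (Y : 'rV[R]_n),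
    chart_image i x ->
    (vertical_lift A *m Sg i (row_mx x t) *m
      (horizontal_lift (g i) x t Y)^T) 0 0 = 0;
  sasaki_HH : forall i x (t : tensor R n p q) (X Y : 'rV[R]_n),
    chart_image i x ->
    (horizontal_lift (g i) x t X *m Sg i (row_mx x t) *m
      (horizontal_lift (g i) x t Y)^T) 0 0 =
    local_fun f i x * (X *m g i x *m Y^T) 0 0
}.

(** The prescribed values are consistent. *)
Lemma rescaled_sasaki_exists (g : riemannian_metric M) (f : M -> R) :
  exists Sg, is_rescaled_sasaki g f Sg.
Proof.
pose Gam i x (t : tensor R n p q) := \matrix_(s < n, k < #|multi n p q|)
  (\sum_(mu < q) \sum_m christoffel (g i) x m s ((enum_val k).2 mu) *
      tcomp t (enum_val k).1 (subst_index (enum_val k).2 mu m)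
   - \sum_(la < p) \sum_m christoffel (g i) x ((enum_val k).1 la) s m *
      tcomp t (subst_index (enum_val k).1 la m) (enum_val k).2).
have hliftE i x t X :
    horizontal_lift (g i) x t X = row_mx X (X *m Gam i x t).
  by congr row_mx; apply/rowP => k; rewrite !mxE; apply: eq_bigr => s _;
     rewrite !mxE.
pose H (G : 'M[R]_n) := \matrix_(a < #|multi n p q|, b < #|multi n p q|)
  (lower_prod G (enum_val a).1 (enum_val b).1 *
   lower_prod (invmx G) (enum_val a).2 (enum_val b).2).
have HE G A B : (A *m H G *m B^T) 0 0 = fibre_product G A B.
  rewrite mxE /fibre_product.
  under [RHS]eq_bigr do rewrite exchange_big /=.
  rewrite (pair_bigA _ (fun i j => \sum_c \sum_l lower_prod G i c *
    lower_prod (invmx G) j l * tcomp A i j * tcomp B c l)) /=.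
  under [RHS]eq_bigr => u _ do rewrite (pair_bigA _ (fun c l =>
    lower_prod G u.1 c * lower_prod (invmx G) u.2 l * tcomp A u.1 u.2 *
    tcomp B c l)) /=.
  rewrite exchange_big /=.
  rewrite (reindex (@enum_rank (multi n p q))) /=; last first.
    by exists enum_val => ? _; rewrite ?enum_valK ?enum_rankK.
  apply: eq_bigr => v _; rewrite !mxE mulr_suml.
  rewrite (reindex (@enum_rank (multi n p q))) /=; last first.
    by exists enum_val => ? _; rewrite ?enum_valK ?enum_rankK.
  apply: eq_bigr => u _; rewrite !mxE !enum_rankK /tcomp.
  by rewrite -!surjective_pairing [A _ _ * _]mulrC.
have Hsym G : G^T = G -> (H G)^T = H G.
  move=> Gs; apply/matrixP => a b; rewrite !mxE /lower_prod.
  have Gs' : (invmx G)^T = invmx G by rewrite trmx_inv Gs.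
  congr (_ * _); apply: eq_bigr => m _.
    by rewrite -[in LHS]Gs mxE.
  by rewrite -[in LHS]Gs' mxE.
pose S i x t := block_mx
  (local_fun f i x *: g i x + Gam i x t *m H (g i x) *m (Gam i x t)^T)
  (- (Gam i x t *m H (g i x))) (- (H (g i x) *m (Gam i x t)^T)) (H (g i x)).
exists (fun i z => S i (lsubmx z) (rsubmx z)).
have hS i x t X : horizontal_lift (g i) x t X *m S i x t =
    row_mx (local_fun f i x *: (X *m g i x)) 0.
  rewrite hliftE mul_row_block !mulmxDr !mulmxN !mulmxA -scalemxAr addrK.
  by rewrite addNr.
split=> i x t; rewrite ?row_mxKl ?row_mxKr.
- move=> xi; rewrite tr_block_mx !linearN /= linearD linearZ /= !trmx_mul.
  by rewrite trmxK !Hsym ?metric_sym // mulmxA.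
- move=> A B xi; rewrite mul_row_block tr_row_mx mul_row_col !mul0mx !add0r.
  by rewrite trmx0 mulmx0 add0r HE.
- move=> A Y xi; rewrite hliftE mul_row_block tr_row_mx mul_row_col !mul0mx.
  by rewrite !add0r trmx_mul mulmxN mulNmx !mulmxA addNr mxE.
- move=> X Y xi; rewrite hS hliftE tr_row_mx mul_row_col mul0mx addr0.
  by rewrite -scalemxAl mxE.
Qed.

Definition local_base (i : chart_index M) (c : R -> tensor_bundle) (t : R) :
  'rV[R]_n := chart_coord (atlas i) (base (c t)).

Definition local_tensor (i : chart_index M) (c : R -> tensor_bundle) (t : R) :
  tensor R n p q := components (c t) i.

Definition local_curve (i : chart_index M) (c : R -> tensor_bundle) (t : R) :
  'rV[R]_(n + #|multi n p q|) := row_mx (local_base i c t) (local_tensor i c t).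

Definition chart_times (J : set R) (i : chart_index M)
  (c : R -> tensor_bundle) : set R :=
  [set t | J t /\ chart_dom (atlas i) (base (c t))].

(** A smooth curve on [J] whose covariant acceleration with respect to the
    Levi-Civita connection of [Sg] vanishes. Continuity of the projection makes
    the sets [chart_times J i c] open, and smoothness is then tested in the
    induced charts. *)
Record is_geodesic (Sg : chart_index M -> 'rV[R]_(n + #|multi n p q|) ->
                         'M[R]_(n + #|multi n p q|))
    (J : set R) (c : R -> tensor_bundle) : Prop := IsGeodesic {
  geodesic_cont : forall t, J t -> {for t, continuous (base \o c)};
  geodesic_smooth : forall i,
    smooth_curve_on (chart_times J i c) (local_curve i c);
  geodesic_eq : forall i t, chart_times J i c t ->
    forall a, acceleration (Sg i) (local_curve i c) t a = 0
}.

End TensorBundle.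

(* Main.v *)
Require Import Defs.
From HB Require Import structures.
From mathcomp Require Import all_boot all_order all_algebra.
From mathcomp Require Import all_classical all_reals all_analysis.
From mathcomp Require Import fingroup perm.
From mathcomp Require Import ring.
Import Order.TTheory GRing.Theory Num.Theory.
Import numFieldNormedType.Exports.
Local Open Scope classical_set_scope.
Local Open Scope ring_scope.

(** The components of the metric on the bundle involve the Christoffel symbols,
    so its own Christoffel symbols are unwieldy. They are avoided: contracted
    with an arbitrary tangent vector w, the geodesic equation is the
    Euler-Lagrange equation of the kinetic energy ([geodesic_euler_lagrange])
<<
      S(w, z'') + (d_z' S)(w, z') - 1/2 (d_w S)(z', z') = 0,
>>
    and only the values of the metric S on pairs of vectors have to be
    differentiated. In an induced chart a tangent vector w = (X, A) at (x, t) has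
    the vertical part A - t B_X, where B_X is the matrix by which the connection
    form in the direction X acts on the components of tensors, and
<<
      S(w, u) = f g(X, Y) + h(vertical part of w, vertical part of u),
>>
    for a vector u projecting to Y, with h the metric that g induces on the fibres.
    Along the curve the vertical part of the velocity is T = delta t / dt. In the
    derivative of this formula those of g and h are expressed by the connection,
    both metrics being parallel ([mdiff_metric], [mdiff_fibre_metric]); those of
    B_X remain, and end up in the curvature.

    A vertical w leaves delta T / dt = 0 ([vertical_equation]). A horizontal w,
    the lift of W, leaves ([horizontal_equation])
<<
      f g(W, delta x' / dt) + df(x') g(W, x') - 1/2 df(W) g(x', x')
        + h(t K(W, x'), T) = 0,
>>
    where K(W, X) = B_W B_X - B_X B_W + d_W B_X - d_X B_W. The commutator of two
    actions on tensors is the action of the commutator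
    ([tensor_action_commutator]), so by the structure equation ([riemannE]) K is
    the action on tensors of the curvature of g. Taking for W the r-th row of
    g^-1 raises the index, and division by f > 0 gives the first equation.

    All actions on tensors are handled by one device, the Kronecker products of
    families of matrices indexed by the p + q slots: the fibre metric is a
    Kronecker product, and B_X a sum of Kronecker products which are the identity
    in all slots but one. *)

Set Implicit Arguments.
Unset Strict Implicit.
Unset Printing Implicit Defensive.

(** * Differentials of matrix-valued maps *)

Section Differentiation.
Context {R : realType} {V : normedModType R}.

Lemma is_diff_ext (f g df dg : V -> R) (x : V) :
  is_diff x f df -> f =1 g -> df =1 dg -> is_diff x g dg.
Proof. by move=> dfx /funext <- /funext <-. Qed.

Lemma is_diff_differentiable (f df : V -> R) (x : V) :
  is_diff x f df -> differentiable f x.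
Proof. by case. Qed.

Lemma is_diff_near (f g df : V -> R) (x : V) :
  (\forall y \near x, f y = g y) -> is_diff x f df -> is_diff x g df.
Proof.
move=> fg dfx.
have f_diff : differentiable f x by exact: ex_diff.
have gE : g \o shift x = cst (g x) + 'd f x +o_ 0 id.
  apply/eqaddoP => e e0.
  have /diff_locally/eqaddoP/(_ e e0) := f_diff.
  rewrite (nbhs_singleton fg).
  have fg0 : \forall h \near 0, f (h + x) = g (h + x).
    by move: fg; rewrite (near_shift 0) /= subr0.
  by apply: filterS2 fg0 => h; rewrite /= !fctE /= => ->.
have dgE := diff_unique (diff_continuous f_diff) gE.
apply: DiffDef; last by rewrite dgE diff_val.
by apply/diff_locallyP; rewrite dgE; split => //; exact: diff_continuous.
Qed.

Lemma is_diff_sum (I : finType) (F dF : I -> V -> R) (x : V) :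
  (forall i, is_diff x (F i) (dF i)) ->
  is_diff x (fun y => \sum_i F i y) (fun v => \sum_i dF i v).
Proof.
move=> dFx; elim: (index_enum I) => [|i r IH].
  by apply: (is_diff_ext (is_diff_cst 0 x)) => y; rewrite big_nil.
by apply: (is_diff_ext (is_diffD (dFx i) IH)) => y; rewrite big_cons !fctE.
Qed.

Lemma is_diff_unique (f df df' : V -> R) (x : V) :
  is_diff x f df -> is_diff x f df' -> df = df'.
Proof. by move=> [_ <-] [_ <-]. Qed.

Lemma is_diff_mul (f g df dg : V -> R) (x : V) :
  is_diff x f df -> is_diff x g dg ->
  is_diff x (fun y => f y * g y) (fun v => df v * g x + f x * dg v).
Proof.
move=> dfx dgx; apply: (is_diff_ext (is_diffM dfx dgx)) => // v.
by rewrite !fctE addrC; congr (_ + _); rewrite mulrC.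
Qed.

Lemma is_diff_prod (I : finType) (F dF : I -> V -> R) (x : V) :
  (forall i, is_diff x (F i) (dF i)) ->
  is_diff x (fun y => \prod_i F i y)
    (fun v => \sum_i \prod_j (if j == i then dF i v else F j x)).
Proof.
move=> dFx.
suff H (r : seq I) : uniq r -> is_diff x (fun y => \prod_(i <- r) F i y)
    (fun v => \sum_(i <- r) \prod_(j <- r) (if j == i then dF i v else F j x)).
  have := H (index_enum I) (index_enum_uniq I); exact.
elim: r => [_|i r IH /= /andP[ir ur]].
  by apply: (is_diff_ext (is_diff_cst (1 : R) x)) => y; rewrite !big_nil.
apply: (is_diff_ext (is_diff_mul (dFx i) (IH ur))) => [y|v].
  by rewrite big_cons.
rewrite big_cons big_cons eqxx; congr (_ * _ + _).
  apply: eq_big_seq => j jr; case: eqP => // ji; by rewrite -ji jr in ir.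
rewrite mulr_sumr; apply: eq_big_seq => k kr; rewrite big_cons.
by case: eqP => // ik; rewrite ik kr in ir.
Qed.

End Differentiation.

(** Differentials of matrix-valued maps are taken entrywise, which reduces every
    rule to one about real functions. *)
Definition mdiff {R : realType} {V : normedModType R} {m n : nat}
  (A : V -> 'M[R]_(m, n)) (x : V) (dA : V -> 'M[R]_(m, n)) : Prop :=
  forall i j, is_diff x (fun y => A y i j) (fun v => dA v i j).

Section MatrixDifferentiation.
Context {R : realType} {V : normedModType R}.

Lemma mdiff_ext m n (A dA dA' : V -> 'M[R]_(m, n)) x :
  dA =1 dA' -> mdiff A x dA -> mdiff A x dA'.
Proof. by move=> /funext <-. Qed.

Lemma mdiff_cst m n (A : 'M[R]_(m, n)) (x : V) : mdiff (cst A) x (fun=> 0).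
Proof.
move=> i j; apply: (is_diff_ext (is_diff_cst (A i j) x)) => // v.
by rewrite mxE.
Qed.

Lemma mdiffD m n (A B dA dB : V -> 'M[R]_(m, n)) x :
  mdiff A x dA -> mdiff B x dB ->
  mdiff (fun y => A y + B y) x (fun v => dA v + dB v).
Proof.
move=> dAx dBx i j.
by apply: (is_diff_ext (is_diffD (dAx i j) (dBx i j))) => v;
  rewrite mxE.
Qed.

Lemma mdiffN m n (A dA : V -> 'M[R]_(m, n)) x :
  mdiff A x dA -> mdiff (fun y => - A y) x (fun v => - dA v).
Proof.
move=> dAx i j.
by apply: (is_diff_ext (is_diffN (dAx i j))) => v; rewrite mxE.
Qed.

Lemma mdiff_sum (I : finType) m n (A dA : I -> V -> 'M[R]_(m, n)) x :
  (forall k, mdiff (A k) x (dA k)) ->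
  mdiff (fun y => \sum_k A k y) x (fun v => \sum_k dA k v).
Proof.
move=> dAx i j.
apply: (is_diff_ext
  (is_diff_sum (fun k => dAx k i j))) => v;
by rewrite summxE.
Qed.

Lemma mdiff_mul m n k (A dA : V -> 'M[R]_(m, n)) (B dB : V -> 'M[R]_(n, k)) x :
  mdiff A x dA -> mdiff B x dB ->
  mdiff (fun y => A y *m B y) x (fun v => dA v *m B x + A x *m dB v).
Proof.
move=> dAx dBx i j.
apply: (is_diff_ext (is_diff_sum
  (fun l => is_diff_mul (dAx i l) (dBx l j)))) => v.
  by rewrite mxE.
by rewrite !mxE -big_split.
Qed.

Lemma mdiff_tr m n (A dA : V -> 'M[R]_(m, n)) x :
  mdiff A x dA -> mdiff (fun y => (A y)^T) x (fun v => (dA v)^T).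
Proof.
move=> dAx i j.
by apply: (is_diff_ext (dAx j i)) => v; rewrite mxE.
Qed.

Lemma mdiff_comp (U : normedModType R) m n (phi dphi : U -> V) (x : U)
    (A dA : V -> 'M[R]_(m, n)) :
  is_diff x phi dphi -> mdiff A (phi x) dA ->
  mdiff (fun y => A (phi y)) x (fun v => dA (dphi v)).
Proof. by move=> dphix dAx i j; exact: is_diff_comp (dAx i j). Qed.

Lemma mdiff_near m n (A B dA : V -> 'M[R]_(m, n)) (x : V) :
  (\forall y \near x, A y = B y) -> mdiff A x dA -> mdiff B x dA.
Proof.
move=> AB dAx i j; apply: is_diff_near (dAx i j).
by apply: filterS AB => y ->.
Qed.

Lemma mdiff_exists m n (A : V -> 'M[R]_(m, n)) (x : V) :
  (forall i j, differentiable (fun y => A y i j) x) ->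
  mdiff A x (fun v => \matrix_(i, j) 'd (fun y => A y i j) x v).
Proof.
move=> Adiff i j; apply: (is_diff_ext (differentiableP (Adiff i j))) => // v.
by rewrite mxE.
Qed.

Lemma mdiff_unique m n (A dA dA' : V -> 'M[R]_(m, n)) (x : V) :
  mdiff A x dA -> mdiff A x dA' -> dA =1 dA'.
Proof.
move=> dAx dAx' v; apply/matrixP => i j.
exact: (congr1 (@^~ v) (is_diff_unique (dAx i j) (dAx' i j))).
Qed.

Lemma differentiable_det n (A dA : V -> 'M[R]_n) (x : V) :
  mdiff A x dA -> differentiable (fun y => \det (A y)) x.
Proof.
move=> dAx; have /@ex_diff := is_diff_sum (fun s : 'S_n => is_diff_mul
  (is_diff_cst ((-1) ^+ s : R) x) (is_diff_prod (fun i => dAx i (s i)))).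
exact.
Qed.

(** The product rule applied to a matrix times its inverse determines the
    differential of the inverse, as soon as that one exists; it does, the
    entries of the inverse being rational functions by Cramer's rule. *)
Lemma mdiff_invmx n (A dA : V -> 'M[R]_n) (x : V) :
  (\forall y \near x, A y \in unitmx) -> mdiff A x dA ->
  mdiff (fun y => invmx (A y)) x
    (fun v => - (invmx (A x) *m dA v *m invmx (A x))).
Proof.
move=> Au dAx; have Ax := nbhs_singleton Au.
have invA_diff i j : differentiable (fun y => invmx (A y) i j) x.
  have det_diff := differentiable_det dAx.
  have adj_diff : differentiable (fun y => \adj (A y) i j) x.
    have minor_diff : mdiff (fun y => row' j (col' i (A y))) x
        (fun v => row' j (col' i (dA v))).
      move=> a b; apply: (is_diff_ext (dAx (lift j a) (lift i b))) => y;
      by rewrite !mxE.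
    have /differentiableP dm := differentiable_det minor_diff.
    have dc := is_diff_mul (is_diff_cst ((-1) ^+ (j + i) : R) x) dm.
    refine (@ex_diff _ _ _ _ _ _ _ (is_diff_ext dc _ (frefl _))) => y.
    by rewrite mxE.
  have det_neq0 : \det (A x) != 0 by rewrite -unitfE -unitmxE.
  have /differentiableP dq :=
    differentiableM (differentiableV det_diff det_neq0) adj_diff.
  refine (@ex_diff _ _ _ _ _ _ _ (is_diff_near _ dq)).
  by apply: filterS Au => y Ay; rewrite /invmx Ay mxE.
pose dInv v := \matrix_(i, j) 'd (fun y => invmx (A y) i j) x v.
have dInvx : mdiff (fun y => invmx (A y)) x dInv.
  move=> i j; apply: (is_diff_ext (differentiableP (invA_diff i j))) => // v.
  by rewrite mxE.
have AinvA : mdiff (cst 1%:M) x (fun v => dA v *m invmx (A x) + A x *m dInv v).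
  apply: mdiff_near (mdiff_mul dAx dInvx).
  by apply: filterS Au => y Ay; rewrite mulmxV.
apply: mdiff_ext dInvx => v.
have := mdiff_unique AinvA (mdiff_cst 1%:M x) v.
move/(congr1 (mulmx (invmx (A x)))).
by rewrite mulmxDr mulmx0 mulKmx // mulmxA => /eqP; rewrite addrC addr_eq0 => /eqP.
Qed.

End MatrixDifferentiation.

Section LinearMaps.
Context {R : realType}.

Lemma is_diff_linear (V W : normedModType R) (l : {linear V -> W}) (x : V) :
  continuous l -> is_diff x l l.
Proof.
by move=> lc; apply: DiffDef; [exact: linear_differentiable|rewrite diff_lin].
Qed.

Lemma is_diff_coord m n (A : 'M[R]_(m, n)) i j :
  is_diff A (fun B : 'M[R]_(m, n) => B i j : R) (fun B => B i j).
Proof.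
have lin : linear (fun B : 'M[R]_(m, n) => B i j : R).
  by move=> a B C; rewrite !mxE.
pose l : {linear 'M[R]_(m, n) -> R} :=
  HB.pack (fun B : 'M[R]_(m, n) => B i j : R) (GRing.isLinear.Build _ _ _ _ _ lin).
by apply: (@is_diff_linear _ _ l); exact: coord_continuous.
Qed.

Lemma is_diff_mdiff (V : normedModType R) m n (A dA : V -> 'M[R]_(m, n)) (x : V) :
  is_diff x A dA -> mdiff A x dA.
Proof. by move=> dAx i j; apply: is_diff_comp dAx (is_diff_coord _ i j). Qed.

Lemma is_diff_lsubmx m n1 n2 (A : 'M[R]_(m, n1 + n2)) :
  is_diff A (lsubmx : 'M[R]_(m, n1 + n2) -> 'M[R]_(m, n1)) lsubmx.
Proof. apply: is_diff_linear; exact: continuous_lsubmx. Qed.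

Lemma is_diff_rsubmx m n1 n2 (A : 'M[R]_(m, n1 + n2)) :
  is_diff A (rsubmx : 'M[R]_(m, n1 + n2) -> 'M[R]_(m, n2)) rsubmx.
Proof. apply: is_diff_linear; exact: continuous_rsubmx. Qed.

End LinearMaps.

(** * Kronecker products over the slots of a tensor *)

Section Kronecker.
Context {R : comNzRingType} {n p q : nat}.
Implicit Types (k l : 'I_p + 'I_q) (u v : multi n p q) (P Q : 'M[R]_n).
Implicit Types A B D E : 'I_p + 'I_q -> 'M[R]_n.

Definition slot_index u k : 'I_n :=
  match k with inl la => u.1 la | inr mu => u.2 mu end.

Definition kron A : 'M[R]_#|multi n p q| :=
  \matrix_(a, b) \prod_k A k (slot_index (enum_val a) k) (slot_index (enum_val b) k).

Definition set_slot A k P := fun l => if l == k then P else A l.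

(** The operator sum over k of 1 (x) ... (x) D_k (x) ... (x) 1 by which an
    infinitesimal change D_k of each slot acts on tensors. *)
Definition leibniz D : 'M[R]_#|multi n p q| :=
  \sum_k kron (set_slot (fun=> 1%:M) k (D k)).

Lemma sum_enum_multi (F : 'I_#|multi n p q| -> R) :
  \sum_a F a = \sum_(u : multi n p q) F (enum_rank u).
Proof.
rewrite (reindex (@enum_rank (multi n p q))) //.
by exists enum_val => ? _; rewrite ?enum_valK ?enum_rankK.
Qed.

(** A multi-index chooses an index in each slot independently, so sums over
    multi-indices of products over slots distribute. *)
Lemma sum_multi_prod (F : 'I_p + 'I_q -> 'I_n -> R) :
  \sum_(u : multi n p q) \prod_k F k (slot_index u k) = \prod_k \sum_m F k m.
Proof.
rewrite bigA_distr_bigA /=.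
pose h (w : {ffun 'I_p + 'I_q -> 'I_n}) : multi n p q :=
  ([ffun la => w (inl la)], [ffun mu => w (inr mu)]).
rewrite (reindex h) /=.
  by apply: eq_bigr => w _; apply: eq_bigr => -[la|mu] _; rewrite /= ffunE.
exists (fun u => [ffun k => slot_index u k]) => [w _|[u1 u2] _].
  by apply/ffunP => -[la|mu]; rewrite !ffunE /= ffunE.
by congr pair; apply/ffunP => la; rewrite !ffunE.
Qed.

Lemma eq_kron A B : A =1 B -> kron A = kron B.
Proof. by move=> /funext ->. Qed.

Lemma kron_mul A B : kron A *m kron B = kron (fun k => A k *m B k).
Proof.
apply/matrixP => a b; rewrite !mxE sum_enum_multi.
transitivity (\sum_(u : multi n p q) \prod_k
    (A k (slot_index (enum_val a) k) (slot_index u k) *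
     B k (slot_index u k) (slot_index (enum_val b) k))).
  by apply: eq_bigr => u _; rewrite !mxE enum_rankK -big_split.
rewrite (sum_multi_prod (fun k m => A k (slot_index (enum_val a) k) m *
  B k m (slot_index (enum_val b) k))).
by apply: eq_bigr => k _; rewrite mxE.
Qed.

Lemma slot_index_inj u v : slot_index u =1 slot_index v -> u = v.
Proof.
case: u v => [u1 u2] [v1 v2] uv; congr pair; apply/ffunP => k.
  exact: (uv (inl k)).
exact: (uv (inr k)).
Qed.

Lemma kron1 : kron (fun=> 1%:M) = 1%:M.
Proof.
apply/matrixP => a b; rewrite !mxE.
under eq_bigr do rewrite mxE.
have [->|ab] := eqVneq a b; first by rewrite big1 // => k _; rewrite eqxx.
have [k kab] : exists k,
    slot_index (enum_val a) k != slot_index (enum_val b) k.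
  apply/existsP; apply: contraR ab => /existsPn eqab; apply/eqP.
  by apply/enum_val_inj/slot_index_inj => k; apply/eqP; have := eqab k;
     rewrite negbK.
by rewrite (bigD1 k) //= (negbTE kab) mul0r.
Qed.

Lemma kron_tr A : (kron A)^T = kron (fun k => (A k)^T).
Proof.
by apply/matrixP => a b; rewrite !mxE; apply: eq_bigr => k _; rewrite mxE.
Qed.

Lemma kron_set_slotE A k P a b :
  kron (set_slot A k P) a b =
  P (slot_index (enum_val a) k) (slot_index (enum_val b) k) *
  \prod_(l | l != k)
    A l (slot_index (enum_val a) l) (slot_index (enum_val b) l).
Proof.
rewrite mxE (bigD1 k) //= /set_slot eqxx; congr (_ * _).
by apply: eq_bigr => l /negbTE ->.
Qed.

Lemma kron_set_slotD A k P Q :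
  kron (set_slot A k (P + Q)) = kron (set_slot A k P) + kron (set_slot A k Q).
Proof.
by apply/matrixP => a b; rewrite [RHS]mxE !kron_set_slotE mxE mulrDl.
Qed.

Lemma kron_set_slotZ A k c P :
  kron (set_slot A k (c *: P)) = c *: kron (set_slot A k P).
Proof.
by apply/matrixP => a b; rewrite [RHS]mxE !kron_set_slotE mxE mulrA.
Qed.

Lemma leibnizD D E : leibniz (fun k => D k + E k) = leibniz D + leibniz E.
Proof. by rewrite -big_split; apply: eq_bigr => k _; exact: kron_set_slotD. Qed.

Lemma leibnizZ c D : leibniz (fun k => c *: D k) = c *: leibniz D.
Proof. by rewrite scaler_sumr; apply: eq_bigr => k _; exact: kron_set_slotZ. Qed.

Lemma leibniz_tr D : (leibniz D)^T = leibniz (fun k => (D k)^T).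
Proof.
rewrite linear_sum; apply: eq_bigr => k _; rewrite /= kron_tr.
by apply: eq_kron => l; rewrite /set_slot; case: eqP => // _; rewrite trmx1.
Qed.

Lemma leibniz_mul_kron D A :
  leibniz D *m kron A = \sum_k kron (set_slot A k (D k *m A k)).
Proof.
rewrite mulmx_suml; apply: eq_bigr => k _; rewrite kron_mul; apply: eq_kron => l.
by rewrite /set_slot; case: eqP => [->|] //; rewrite mul1mx.
Qed.

Lemma kron_mul_leibniz A D :
  kron A *m leibniz D = \sum_k kron (set_slot A k (A k *m D k)).
Proof.
rewrite mulmx_sumr; apply: eq_bigr => k _; rewrite kron_mul; apply: eq_kron => l.
by rewrite /set_slot; case: eqP => [->|] //; rewrite mulmx1.
Qed.

(** Operators acting on different slots commute, so only the commutators
    within each slot survive. *)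
Lemma leibniz_commutator D E :
  leibniz D *m leibniz E - leibniz E *m leibniz D =
  leibniz (fun k => D k *m E k - E k *m D k).
Proof.
have mulE D' E' : leibniz D' *m leibniz E' = leibniz (fun k => D' k *m E' k) +
    \sum_k \sum_(l | l != k)
      kron (set_slot (set_slot (fun=> 1%:M) k (D' k)) l (E' l)).
  rewrite mulmx_suml -big_split; apply: eq_bigr => k _ /=.
  rewrite mulmx_sumr (bigD1 k) //=; congr (_ + _).
    rewrite kron_mul; apply: eq_kron => j; rewrite /set_slot.
    by case: eqP => // _; rewrite mul1mx.
  apply: eq_bigr => l lk; rewrite kron_mul; apply: eq_kron => j.
  rewrite /set_slot; case: (eqVneq j k) => [->|_]; last by rewrite mul1mx.
  by rewrite [k == l]eq_sym (negbTE lk) mulmx1.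
rewrite (mulE D E) (mulE E D) opprD addrACA.
rewrite [X in _ + (X - _)](_ : _ = \sum_k \sum_(l | l != k)
    kron (set_slot (set_slot (fun=> 1%:M) k (E k)) l (D l))).
  rewrite subrr addr0 leibnizD; congr (_ + _).
  by rewrite -scaleN1r -leibnizZ; congr leibniz; apply/funext => k;
     rewrite scaleN1r.
rewrite (exchange_big_dep predT) //=; apply: eq_bigr => k _.
apply: eq_big => l; first by rewrite eq_sym.
move=> kl; apply: eq_kron => j; rewrite /set_slot.
by case: (eqVneq j k) => // ->; rewrite (negbTE kl).
Qed.

End Kronecker.

Section TensorSlots.
Context {R : realType} {n p q : nat}.
Implicit Types (P Q G : 'M[R]_n) (t : tensor R n p q).

(** The matrices of the action of P on each slot: P itself on a covariant
    index, minus its transpose on a contravariant one, since a parallel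
    covector is transported dually to a parallel vector. With this sign t is
    parallel along the curve x when t' is t times the action of the connection
    form in the direction x'. *)
Definition slot_action P (k : 'I_p + 'I_q) : 'M[R]_n :=
  if k is inl _ then - P^T else P.

Definition tensor_action P : 'M[R]_#|multi n p q| := leibniz (slot_action P).

Definition slot_metric G (k : 'I_p + 'I_q) : 'M[R]_n :=
  if k is inl _ then G else invmx G.

Definition fibre_metric G : 'M[R]_#|multi n p q| := kron (slot_metric G).

Lemma tensor_actionD P Q :
  tensor_action (P + Q) = tensor_action P + tensor_action Q.
Proof.
rewrite -leibnizD; congr leibniz; apply/funext => -[k|k] //=.
by rewrite linearD opprD.
Qed.

Lemma tensor_actionZ c P : tensor_action (c *: P) = c *: tensor_action P.
Proof.
rewrite -leibnizZ; congr leibniz; apply/funext => -[k|k] //=.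
by rewrite linearZ scalerN.
Qed.

Lemma tensor_actionN P : tensor_action (- P) = - tensor_action P.
Proof. by rewrite -scaleN1r tensor_actionZ scaleN1r. Qed.

Lemma tensor_action0 : tensor_action 0 = 0.
Proof. by rewrite -(scale0r 0) tensor_actionZ scale0r. Qed.

Lemma tensor_action_sum (I : finType) (P : I -> 'M[R]_n) :
  tensor_action (\sum_i P i) = \sum_i tensor_action (P i).
Proof.
by elim/big_rec2: _ => [|i _ Q _ <-]; rewrite ?tensor_action0 ?tensor_actionD.
Qed.

Lemma tensor_action_commutator P Q :
  tensor_action P *m tensor_action Q - tensor_action Q *m tensor_action P =
  tensor_action (P *m Q - Q *m P).
Proof.
rewrite leibniz_commutator; congr leibniz; apply/funext => -[k|k] //=.
by rewrite !mulNmx !mulmxN !opprK linearB /= !trmx_mul opprB.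
Qed.

Definition subst_slot (v : multi n p q) (k : 'I_p + 'I_q) (m : 'I_n) :
  multi n p q :=
  match k with
  | inl la => (subst_index v.1 la m, v.2)
  | inr mu => (v.1, subst_index v.2 mu m)
  end.

Lemma slot_index_subst v k m l :
  slot_index (subst_slot v k m) l = if l == k then m else slot_index v l.
Proof. by case: k l => [k|k] [l|l] //=; rewrite ffunE. Qed.

(** In the product with the matrix of a single slot only those multi-indices
    survive that agree with v in all other slots. *)
Lemma mul_kron_set_slot t k P (v : multi n p q) :
  (t *m kron (set_slot (fun=> 1%:M) k P)) 0 (enum_rank v) =
  \sum_m P m (slot_index v k) * t 0 (enum_rank (subst_slot v k m)).
Proof.
rewrite mxE sum_enum_multi.
transitivity (\sum_(u : multi n p q) \sum_m
    (u == subst_slot v k m)%:R * (P m (slot_index v k) * t 0 (enum_rank u)));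
  last first.
  rewrite exchange_big; apply: eq_bigr => m _ /=.
  rewrite (bigD1 (subst_slot v k m)) //= eqxx mul1r big1 ?addr0 // => u.
  by move=> /negbTE ->; rewrite mul0r.
apply: eq_bigr => u _; rewrite kron_set_slotE !enum_rankK.
rewrite (bigD1 (slot_index u k)) //= [X in _ + X]big1 ?addr0; last first.
  move=> m mu; case: eqP => [uE|_]; last by rewrite mul0r.
  by move: mu; rewrite [in slot_index u k]uE slot_index_subst eqxx eqxx.
rewrite mulrA mulrC; congr (_ * _); rewrite mulrC; congr (_ * _).
  under eq_bigr do rewrite mxE.
  case: eqP => [uE|uE].
    rewrite big1 // => l /negbTE lk.
    by rewrite [in slot_index u l]uE slot_index_subst lk eqxx.
  have [l lk luv] : exists2 l, l != k & slot_index u l != slot_index v l.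
    apply/exists_inP; apply: contra_notT uE => /exists_inPn eq_uv.
    apply: slot_index_inj => l; rewrite slot_index_subst.
    case: (eqVneq l k) => [->//|lk]; apply/eqP.
    by have := eq_uv l lk; rewrite negbK.
  by rewrite (bigD1 l) //= (negbTE luv) mul0r.
Qed.

Lemma mul_tensor_action t P :
  t *m tensor_action P = mk_tensor (fun i j =>
    \sum_(mu < q) \sum_m P m (j mu) * tcomp t i (subst_index j mu m)
    - \sum_(la < p) \sum_m P (i la) m * tcomp t (subst_index i la m) j).
Proof.
apply/rowP => a; rewrite -[a]enum_valK; move: (enum_val a) => [i j].
rewrite [RHS]mxE enum_rankK /= mulmx_sumr summxE big_sumType /= addrC.
under eq_bigr do rewrite mul_kron_set_slot.
congr (_ + _); rewrite -sumrN; apply: eq_bigr => la _.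
rewrite mul_kron_set_slot -sumrN; apply: eq_bigr => m _ /=.
by rewrite !mxE mulNr.
Qed.

Lemma tensor_action_contract t (X : 'rV[R]_n) (C : 'I_n -> 'M[R]_n) i j :
  tcomp (t *m tensor_action (\matrix_(a, b) \sum_s X 0 s * C s a b)) i j =
  \sum_s X 0 s * (\sum_(mu < q) \sum_m
     C s m (j mu) * tcomp t i (subst_index j mu m)
   - \sum_(la < p) \sum_m C s (i la) m * tcomp t (subst_index i la m) j).
Proof.
have -> : \matrix_(a, b) (\sum_s X 0 s * C s a b) = \sum_s X 0 s *: C s.
  by apply/matrixP => a b; rewrite !mxE summxE; apply: eq_bigr => s _; rewrite mxE.
rewrite tensor_action_sum mulmx_sumr /tcomp summxE; apply: eq_bigr => s _.
by rewrite tensor_actionZ -scalemxAr mxE mul_tensor_action mxE enum_rankK.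
Qed.

Lemma fibre_productE G (t s : tensor R n p q) :
  fibre_product G t s = (t *m fibre_metric G *m s^T) 0 0.
Proof.
have lowerE (u v : multi n p q) : fibre_metric G (enum_rank u) (enum_rank v) =
    lower_prod G u.1 v.1 * lower_prod (invmx G) u.2 v.2.
  by rewrite mxE !enum_rankK big_sumType.
rewrite mxE sum_enum_multi.
under [RHS]eq_bigr => v _ do rewrite mxE sum_enum_multi mulr_suml.
rewrite [RHS]exchange_big /=.
rewrite /fibre_product; under [LHS]eq_bigr do rewrite exchange_big /=.
rewrite (pair_bigA _ (fun i j => \sum_c \sum_l lower_prod G i c *
  lower_prod (invmx G) j l * tcomp t i j * tcomp s c l)) /=.
apply: eq_bigr => -[i j] _ /=; rewrite (pair_bigA _ (fun c l =>
  lower_prod G i c * lower_prod (invmx G) j l * tcomp t i j * tcomp s c l)) /=.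
apply: eq_bigr => -[c l] _ /=; rewrite lowerE mxE /tcomp /=.
by congr (_ * _); rewrite mulrC.
Qed.

(** Slotwise inverses give an inverse of a Kronecker product. *)
Lemma fibre_metric_unit G : G \in unitmx -> fibre_metric G \in unitmx.
Proof.
move=> Gu; have /mulmx1_unit[] // :
    fibre_metric G *m kron (fun k => invmx (slot_metric G k)) = 1%:M.
rewrite kron_mul -kron1; apply: eq_kron => -[k|k] /=.
  by rewrite mulmxV.
by rewrite mulmxV // unitmx_inv.
Qed.

Lemma fibre_metric_sym G : G^T = G -> (fibre_metric G)^T = fibre_metric G.
Proof.
move=> Gs; rewrite kron_tr; apply: eq_kron => -[k|k] //=.
by rewrite trmx_inv Gs.
Qed.

End TensorSlots.
Arguments tensor_action {R n} p q P.
Arguments fibre_metric {R n} p q G.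

(** * The connection form and parallelism of the fibre metric *)

Section KroneckerDifferential.
Context {R : realType} {V : normedModType R} {n p q : nat}.

Lemma mdiff_kron (A dA : 'I_p + 'I_q -> V -> 'M[R]_n) (x : V) :
  (forall k, mdiff (A k) x (dA k)) ->
  mdiff (fun y => @kron R n p q (A^~ y)) x
    (fun v => \sum_k kron (set_slot (A^~ x) k (dA k v))).
Proof.
move=> dAx a b.
have dprod := is_diff_prod (fun k => dAx k (slot_index (enum_val a) k)
  (slot_index (enum_val b) k)).
apply: (is_diff_ext dprod) => [y|v]; first by rewrite mxE.
rewrite summxE; apply: eq_bigr => k _; rewrite mxE; apply: eq_bigr => l _.
by rewrite /set_slot; case: eqP => [->|].
Qed.

Lemma mdiff_leibniz (D dD : 'I_p + 'I_q -> V -> 'M[R]_n) (x : V) :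
  (forall k, mdiff (D k) x (dD k)) ->
  mdiff (fun y => @leibniz R n p q (D^~ y)) x (fun v => leibniz (dD^~ v)).
Proof.
move=> dDx; apply: mdiff_sum => k a b.
have := is_diff_mul (dDx k (slot_index (enum_val a) k) (slot_index (enum_val b) k))
  (is_diff_cst (\prod_(l | l != k)
     (1%:M : 'M[R]_n) (slot_index (enum_val a) l) (slot_index (enum_val b) l)) x).
move=> dprod; apply: (is_diff_ext dprod) => v; rewrite kron_set_slotE //.
by rewrite [X in _ + X]mulr0 addr0.
Qed.

Lemma mdiff_tensor_action (P dP : V -> 'M[R]_n) (x : V) :
  mdiff P x dP ->
  mdiff (fun y => tensor_action p q (P y)) x (fun v => tensor_action p q (dP v)).
Proof.
move=> dPx; apply: mdiff_leibniz => -[k|k] //=.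
exact/mdiffN/mdiff_tr.
Qed.

End KroneckerDifferential.

Section Connection.
Context {R : realType} {n : nat}.
Implicit Types (G : 'rV[R]_n -> 'M[R]_n) (x X Z : 'rV[R]_n).

(** The matrix of the connection form in the direction X. *)
Definition conn_form G x X : 'M[R]_n :=
  \matrix_(a, b) \sum_s X 0 s * christoffel G x a s b.

(** The derivative in the direction Z of the connection form, X being kept
    constant in the coordinates. *)
Definition conn_form_deriv G x Z X : 'M[R]_n :=
  \matrix_(a, b) \sum_s X 0 s * 'd (fun y => christoffel G y a s b) x Z.

Lemma conn_form0 G x : conn_form G x 0 = 0.
Proof.
by apply/matrixP => a b; rewrite !mxE big1 // => s _; rewrite mxE mul0r.
Qed.

Lemma conn_form_deriv0l G x X : conn_form_deriv G x 0 X = 0.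
Proof.
by apply/matrixP => a b; rewrite !mxE big1 // => s _; rewrite linear0 mulr0.
Qed.

Lemma conn_form_deriv0r G x Z : conn_form_deriv G x Z 0 = 0.
Proof.
by apply/matrixP => a b; rewrite !mxE big1 // => s _; rewrite mxE mul0r.
Qed.

Lemma diff_partial (F : 'rV[R]_n -> R) x Z :
  differentiable F x -> 'd F x Z = \sum_k Z 0 k * partial k F x.
Proof.
move=> dF; rewrite [in LHS](row_sum_delta Z) linear_sum; apply: eq_bigr => k _.
by rewrite linearZ /= /partial deriveE.
Qed.

Lemma tensor_action_conn_form p q G x X (t : tensor R n p q) i j :
  tcomp (t *m tensor_action p q (conn_form G x X)) i j =
  \sum_s X 0 s * (\sum_(mu < q) \sum_m
     christoffel G x m s (j mu) * tcomp t i (subst_index j mu m)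
   - \sum_(la < p) \sum_m
     christoffel G x (i la) s m * tcomp t (subst_index i la m) j).
Proof.
have := tensor_action_contract t X
  (fun s => \matrix_(a, b) christoffel G x a s b) i j.
rewrite [X in tensor_action _ _ X](_ : _ = conn_form G x X).
  move=> ->; apply: eq_bigr => s _; congr (_ * (_ - _));
  by apply: eq_bigr => k _; apply: eq_bigr => m _; rewrite mxE.
by apply/matrixP => a b; rewrite !mxE; apply: eq_bigr => s _; rewrite mxE.
Qed.

Lemma horizontal_liftE p q G x (t : tensor R n p q) X :
  horizontal_lift G x t X = row_mx X (t *m tensor_action p q (conn_form G x X)).
Proof.
congr row_mx; apply/rowP => a; rewrite -[a]enum_valK.
case: (enum_val a) => i j; rewrite mxE enum_rankK /=.
by rewrite -tensor_action_conn_form.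
Qed.

Section MetricOnOpenSet.
Context {U : set 'rV[R]_n} {G : 'rV[R]_n -> 'M[R]_n}.
Hypotheses (U_open : open U) (G_smooth : forall a b, smooth_on U (fun x => G x a b)).
Hypotheses (G_sym : forall x, U x -> (G x)^T = G x).
Hypothesis (G_unit : forall x, U x -> G x \in unitmx).

Let near_U x : U x -> \forall y \near x, U y.
Proof. by move=> Ux; apply: open_nbhs_nbhs; split. Qed.

Lemma christoffel_sym x : U x -> forall h i j,
  christoffel G x h i j = christoffel G x h j i.
Proof.
move=> Ux; have [] // := @christoffel_levi_civita _ _ G x (G_unit Ux).
by apply: filterS (near_U Ux) => y; exact: G_sym.
Qed.

(** Absence of torsion. *)
Lemma conn_form_sym x X Z : U x ->
  X *m (conn_form G x Z)^T = Z *m (conn_form G x X)^T.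
Proof.
move=> Ux; apply/rowP => a; rewrite !mxE.
under eq_bigr do rewrite !mxE mulr_sumr.
under [RHS]eq_bigr do rewrite !mxE mulr_sumr.
rewrite exchange_big; apply: eq_bigr => s _; apply: eq_bigr => b _.
by rewrite (christoffel_sym Ux a b s) mulrCA.
Qed.

(** Metric compatibility of the Levi-Civita connection, in matrix form. *)
Lemma mdiff_metric x : U x ->
  mdiff G x (fun Z => (conn_form G x Z)^T *m G x + G x *m conn_form G x Z).
Proof.
move=> Ux a b; have dG : differentiable (fun y => G y a b) x.
  by have [dG _] := G_smooth a b 1%N; exact: dG.
have /differentiableP dGx := dG; apply: (is_diff_ext dGx) => // Z.
rewrite diff_partial //; have [_ compat] := christoffel_levi_civita (G_unit Ux)
  (filterS (fun y => @G_sym y) (near_U Ux)).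
under eq_bigr do rewrite compat mulr_sumr.
rewrite exchange_big !mxE -big_split; apply: eq_bigr => m _ /=.
rewrite !mxE mulr_suml mulr_sumr -big_split; apply: eq_bigr => s _ /=.
by rewrite mulrDr mulrA [G x a m * _]mulrCA [_ * G x a m]mulrC.
Qed.

Lemma mdiff_inv_metric x : U x ->
  mdiff (fun y => invmx (G y)) x (fun Z =>
    - (invmx (G x) *m (conn_form G x Z)^T + conn_form G x Z *m invmx (G x))).
Proof.
move=> Ux; have Gu : \forall y \near x, G y \in unitmx.
  by apply: filterS (near_U Ux) => y; exact: G_unit.
apply: mdiff_ext (mdiff_invmx Gu (mdiff_metric Ux)) => Z.
have Gx := G_unit Ux.
by rewrite mulmxDr mulmxDl !mulmxA mulVmx // mul1mx mulmxK.
Qed.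

(** The metric of the fibres is parallel because g is: the derivative of a
    Kronecker product falls on one slot at a time, where metric compatibility,
    for g or for its inverse, turns it into the action on that slot. *)
Lemma mdiff_fibre_metric p q x : U x ->
  mdiff (fun y => fibre_metric p q (G y)) x (fun Z =>
    - (tensor_action p q (conn_form G x Z) *m fibre_metric p q (G x) +
       fibre_metric p q (G x) *m (tensor_action p q (conn_form G x Z))^T)).
Proof.
move=> Ux.
pose d (k : 'I_p + 'I_q) Z := if k is inl _
  then (conn_form G x Z)^T *m G x + G x *m conn_form G x Z
  else - (invmx (G x) *m (conn_form G x Z)^T + conn_form G x Z *m invmx (G x)).
have dmet k : mdiff (fun y => slot_metric (G y) k) x (d k).
  by case: k => k; [exact: mdiff_metric|exact: mdiff_inv_metric].
apply: mdiff_ext (mdiff_kron dmet) => Z.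
rewrite leibniz_tr leibniz_mul_kron kron_mul_leibniz -big_split -sumrN.
apply: eq_bigr => k _ /=; rewrite -kron_set_slotD -scaleN1r -kron_set_slotZ.
congr (kron (set_slot _ _ _)); rewrite scaleN1r; case: k => k /=.
  by rewrite [(- _)^T]linearN /= trmxK mulNmx mulmxN opprD !opprK.
by rewrite addrC.
Qed.

Lemma differentiable_christoffel x h i j : U x ->
  differentiable (fun y => christoffel G y h i j) x.
Proof.
move=> Ux.
have partial_diff k a b : differentiable (partial k (fun y => G y a b)) x.
  by have [_ /(_ k) [dG _]] := G_smooth a b 2%N; exact: dG.
have invG_diff a b := is_diff_differentiable (mdiff_inv_metric Ux a b).
have term_diff m := is_diff_mul (differentiableP (invG_diff h m))
  (is_diffB (is_diffD (differentiableP (partial_diff i m j))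
     (differentiableP (partial_diff j m i))) (differentiableP (partial_diff m i j))).
exact: is_diff_differentiable (is_diff_mul (is_diff_cst (2^-1 : R) x) (is_diff_sum term_diff)).
Qed.

Lemma mdiff_conn_form (V : normedModType R) (phi dphi X dX : V -> 'rV[R]_n) (v : V) :
  U (phi v) -> is_diff v phi dphi -> mdiff X v dX ->
  mdiff (fun y => conn_form G (phi y) (X y)) v
    (fun h => conn_form_deriv G (phi v) (dphi h) (X v) +
              conn_form G (phi v) (dX h)).
Proof.
move=> Uv dphiv dXv a b.
have dchr s := is_diff_comp dphiv
  (differentiableP (differentiable_christoffel a s b Uv)).
have dsum := is_diff_sum (fun s => is_diff_mul (dXv 0 s) (dchr s)).
apply: (is_diff_ext dsum) => [y|h]; first by rewrite mxE.
by rewrite !mxE -big_split; apply: eq_bigr => s _; rewrite addrC.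
Qed.

(** The structure equation: the curvature is the exterior derivative of the
    connection form plus its wedge square. *)
Lemma riemannE x X Z : U x ->
  conn_form G x X *m conn_form G x Z - conn_form G x Z *m conn_form G x X +
  (conn_form_deriv G x X Z - conn_form_deriv G x Z X) =
  \matrix_(s, j) \sum_k \sum_l X 0 k * Z 0 l * riemann G x k l j s.
Proof.
move=> Ux; apply/matrixP => s j; rewrite !mxE.
have prodE (Y W : 'rV[R]_n) :
    \sum_m conn_form G x Y s m * conn_form G x W m j = \sum_k \sum_l
      Y 0 k * W 0 l * \sum_m christoffel G x s k m * christoffel G x m l j.
  under eq_bigr => m _ do rewrite !mxE mulr_suml.
  rewrite exchange_big; apply: eq_bigr => k _ /=.
  under eq_bigr => m _ do rewrite mulr_sumr.
  rewrite exchange_big; apply: eq_bigr => l _ /=.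
  by rewrite mulr_sumr; apply: eq_bigr => m _; rewrite mulrACA.
have derivE (Y W : 'rV[R]_n) : \sum_l W 0 l * 'd (fun y => christoffel G y s l j) x Y =
    \sum_k \sum_l Y 0 k * W 0 l * partial k (fun y => christoffel G y s l j) x.
  rewrite exchange_big; apply: eq_bigr => l _ /=.
  rewrite diff_partial; last exact: differentiable_christoffel.
  by rewrite mulr_sumr; apply: eq_bigr => k _; rewrite mulrCA mulrA.
rewrite !prodE !derivE [X in _ - X + _]exchange_big /=.
rewrite [X in _ + (_ - X)]exchange_big /= -!sumrB -big_split.
apply: eq_bigr => k _ /=; rewrite -!sumrB -big_split; apply: eq_bigr => l _ /=.
by rewrite /riemann sumrB [Z 0 l * _]mulrC -!mulrBr -mulrDr [X in _ * X]addrC.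
Qed.

End MetricOnOpenSet.
End Connection.

(** * The Euler-Lagrange form of the geodesic equation *)

Section EulerLagrange.
Context {R : realType} {N : nat}.
Implicit Types (z v w u : 'rV[R]_N).

Lemma mdiff_partial (S dS : 'rV[R]_N -> 'M[R]_N) z v a b :
  mdiff S z dS -> dS v a b = \sum_i v 0 i * partial i (fun y => S y a b) z.
Proof.
move=> dSz; rewrite -diff_partial; last exact: is_diff_differentiable (dSz a b).
by case: (dSz a b) => _ ->.
Qed.

Lemma quad_formE (A : 'M[R]_N) w u :
  (w *m A *m u^T) 0 0 = \sum_a \sum_b w 0 a * u 0 b * A a b.
Proof.
rewrite mxE; under eq_bigr do rewrite !mxE mulr_suml.
rewrite exchange_big; apply: eq_bigr => a _; apply: eq_bigr => b _ /=.
by rewrite mulrAC.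
Qed.

(** The geodesic equation with its free index lowered, contracted with w:
    the Euler-Lagrange equation of the kinetic energy, in which no inverse of
    the metric occurs. *)
Lemma geodesic_euler_lagrange (S dS : 'rV[R]_N -> 'M[R]_N) z v (acc : 'rV[R]_N) :
  S z \in unitmx -> mdiff S z dS ->
  (forall a, acc 0 a +
    \sum_i \sum_j christoffel S z a i j * v 0 i * v 0 j = 0) ->
  forall w, (w *m S z *m acc^T) 0 0 + (w *m dS v *m v^T) 0 0
            - 2^-1 * (v *m dS w *m v^T) 0 0 = 0.
Proof.
move=> Su dSz geod w.
pose lowered : 'rV[R]_N := \row_b \sum_i \sum_j v 0 i * v 0 j *
  (partial i (fun y => S y b j) z + partial j (fun y => S y b i) z
   - partial b (fun y => S y i j) z).
have accE : acc^T = - 2^-1 *: (invmx (S z) *m lowered^T).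
  apply/colP => a; rewrite !mxE.
  have /eqP := geod a; rewrite addr_eq0 => /eqP ->; rewrite mulNr; congr (- _).
  rewrite mulr_sumr; under [RHS]eq_bigr do rewrite !mxE mulr_sumr mulr_sumr.
  rewrite [RHS]exchange_big; apply: eq_bigr => i _ /=.
  under [RHS]eq_bigr do rewrite mulr_sumr mulr_sumr.
  rewrite [RHS]exchange_big; apply: eq_bigr => j _ /=.
  rewrite /christoffel mulr_sumr !mulr_suml; apply: eq_bigr => m _.
  by ring.
rewrite accE -scalemxAr mulmxA mulmxK // mxE.
suff -> : (w *m lowered^T) 0 0 =
    2 * (w *m dS v *m v^T) 0 0 - (v *m dS w *m v^T) 0 0.
  by field.
have dSvE : (w *m dS v *m v^T) 0 0 = \sum_b w 0 b *
    \sum_i \sum_j v 0 i * v 0 j * partial i (fun y => S y b j) z.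
  rewrite quad_formE; apply: eq_bigr => b _.
  rewrite exchange_big mulr_sumr; apply: eq_bigr => j _ /=.
  rewrite (mdiff_partial _ _ _ dSz) !mulr_sumr; apply: eq_bigr => i _.
  by ring.
have dSwE : (v *m dS w *m v^T) 0 0 = \sum_b w 0 b *
    \sum_i \sum_j v 0 i * v 0 j * partial b (fun y => S y i j) z.
  rewrite quad_formE; under [RHS]eq_bigr do rewrite mulr_sumr.
  rewrite [RHS]exchange_big; apply: eq_bigr => i _ /=.
  under [RHS]eq_bigr do rewrite mulr_sumr.
  rewrite [RHS]exchange_big; apply: eq_bigr => j _ /=.
  rewrite (mdiff_partial _ _ _ dSz) !mulr_sumr; apply: eq_bigr => b _.
  by rewrite mulrCA.
rewrite dSvE dSwE mxE mulr_sumr -sumrB; apply: eq_bigr => b _.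
rewrite !mxE mulrCA -mulrBr; congr (_ * _).
rewrite mulr2n mulrDl mul1r [X in _ = X + _ - _]exchange_big /=.
rewrite -big_split -sumrB; apply: eq_bigr => i _ /=.
rewrite -big_split -sumrB; apply: eq_bigr => j _ /=.
by rewrite !mulrDr mulrN [v 0 j * _]mulrC [X in _ = X - _]addrC.
Qed.

End EulerLagrange.

(** * The Sasaki type metric and its geodesics in a chart *)

Section Dot.
Context {R : comUnitRingType} {m : nat}.
Implicit Types (A B C : 'M[R]_m) (a b c : 'rV[R]_m).

Definition dot A a b : R := (a *m A *m b^T) 0 0.

Lemma dotDl A a b c : dot A (a + b) c = dot A a c + dot A b c.
Proof. by rewrite /dot !mulmxDl mxE. Qed.

Lemma dotDr A a b c : dot A a (b + c) = dot A a b + dot A a c.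
Proof. by rewrite /dot linearD mulmxDr mxE. Qed.

Lemma dotNl A a b : dot A (- a) b = - dot A a b.
Proof. by rewrite /dot !mulNmx mxE. Qed.

Lemma dotNr A a b : dot A a (- b) = - dot A a b.
Proof. by rewrite /dot linearN mulmxN mxE. Qed.

Lemma dot0l A b : dot A 0 b = 0.
Proof. by rewrite /dot !mul0mx mxE. Qed.

Lemma dot0r A a : dot A a 0 = 0.
Proof. by rewrite /dot trmx0 mulmx0 mxE. Qed.

Lemma dotC A a b : A^T = A -> dot A a b = dot A b a.
Proof.
move=> As; rewrite /dot -[in RHS]As.
have -> : b *m A^T *m a^T = (a *m A *m b^T)^T by rewrite !trmx_mul trmxK mulmxA.
by rewrite [RHS]mxE.
Qed.

Lemma dot_delta A i j : dot A (delta_mx 0 i) (delta_mx 0 j) = A i j.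
Proof. by rewrite /dot trmx_delta -rowE -colE !mxE. Qed.

Lemma dot_addmx A B a b : dot (A + B) a b = dot A a b + dot B a b.
Proof. by rewrite /dot mulmxDr mulmxDl mxE. Qed.

Lemma dot_oppmx A a b : dot (- A) a b = - dot A a b.
Proof. by rewrite /dot mulmxN mulNmx mxE. Qed.

Lemma dot_mulmxl C A a b : dot (C *m A) a b = dot A (a *m C) b.
Proof. by rewrite /dot !mulmxA. Qed.

Lemma dot_mulmxr C A a b : dot (A *m C) a b = dot A a (b *m C^T).
Proof. by rewrite /dot trmx_mul trmxK !mulmxA. Qed.

Lemma dot_nondeg A a : A \in unitmx -> (forall b, dot A b a = 0) -> a = 0.
Proof.
move=> Au aA0; apply: trmx_inj; rewrite trmx0 -[LHS](mulKmx Au).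
suff -> : A *m a^T = 0 by rewrite mulmx0.
apply/colP => i; have := aA0 (delta_mx 0 i).
by rewrite /dot -mulmxA -rowE !mxE.
Qed.

End Dot.

Lemma is_diff_dot (R : realType) (V : normedModType R) m
    (A dA : V -> 'M[R]_m) (a da b db : V -> 'rV[R]_m) (x : V) :
  mdiff A x dA -> mdiff a x da -> mdiff b x db ->
  is_diff x (fun y => dot (A y) (a y) (b y))
    (fun v => dot (dA v) (a x) (b x) + dot (A x) (da v) (b x)
              + dot (A x) (a x) (db v)).
Proof.
move=> dAx dax dbx.
have dform := mdiff_mul (mdiff_mul dax dAx) (mdiff_tr dbx) 0 0.
apply: (is_diff_ext dform) => // v.
by rewrite mulmxDl mxE [X in X + _ = _]mxE [X in X + _ = _]addrC.
Qed.

Section SasakiMetric.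
Context {R : realType} {n p q : nat}.
Context {U : set 'rV[R]_n} {G : 'rV[R]_n -> 'M[R]_n} {f : 'rV[R]_n -> R}.
Context {S : 'rV[R]_(n + #|multi n p q|) -> 'M[R]_(n + #|multi n p q|)}.
Implicit Types (x X W Z : 'rV[R]_n) (t T A : tensor R n p q).
Implicit Types w u v : 'rV[R]_(n + #|multi n p q|).
Hypotheses (U_open : open U) (G_smooth : forall a b, smooth_on U (fun x => G x a b)).
Hypotheses (G_sym : forall x, U x -> (G x)^T = G x).
Hypothesis (G_unit : forall x, U x -> G x \in unitmx).
Hypothesis (f_diff : forall x, U x -> differentiable f x).
Hypothesis (f_gt0 : forall x, U x -> 0 < f x).

Local Notation act x X := (tensor_action p q (conn_form G x X)).
Local Notation act' x Z X := (tensor_action p q (conn_form_deriv G x Z X)).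
Local Notation H x := (fibre_metric p q (G x)).

(** The vertical part, with respect to the connection, of a vector tangent to
    the tensor bundle. *)
Definition vertical_part x t w : tensor R n p q :=
  rsubmx w - t *m act x (lsubmx w).

Hypothesis S_dot : forall x t w u, U x ->
  dot (S (row_mx x t)) w u = f x * dot (G x) (lsubmx w) (lsubmx u) +
    dot (H x) (vertical_part x t w) (vertical_part x t u).

(** A vector orthogonal to all vertical vectors is horizontal, as h is
    nondegenerate; a horizontal vector orthogonal to all others projects to 0,
    as f g is. *)
Lemma sasaki_unit x t : U x -> S (row_mx x t) \in unitmx.
Proof.
move=> Ux; rewrite -unitmx_tr -row_free_unit; apply: inj_row_free => w wS0.
have wS u : dot (S (row_mx x t)) u w = 0.
  by rewrite /dot -mulmxA -[S _ *m _]trmxK trmx_mul trmxK wS0 trmx0 mulmx0 mxE.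
have vw0 : vertical_part x t w = 0.
  have Hu : H x \in unitmx by apply: fibre_metric_unit; exact: G_unit.
  apply: (dot_nondeg Hu) => A.
  have := wS (row_mx 0 A); rewrite S_dot // row_mxKl dot0l mulr0 add0r.
  by rewrite /vertical_part row_mxKl row_mxKr conn_form0 tensor_action0 mulmx0 subr0.
have lw0 : lsubmx w = 0.
  apply: (dot_nondeg (G_unit Ux)) => X.
  have /eqP := wS (row_mx X 0); rewrite S_dot // vw0 dot0r addr0 row_mxKl.
  by rewrite mulf_eq0 gt_eqF ?f_gt0 //= => /eqP.
move: vw0; rewrite /vertical_part lw0 conn_form0 tensor_action0 mulmx0 subr0.
by move=> rw0; rewrite -[w]hsubmxK lw0 rw0 row_mx0.
Qed.

(** The derivative of the vertical part of a constant w in the direction v. *)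
Definition vertical_part_deriv x t v w : tensor R n p q :=
  - (rsubmx v *m act x (lsubmx w) + t *m act' x (lsubmx v) (lsubmx w)).

Lemma mdiff_vertical_part x t w : U x ->
  mdiff (fun z => vertical_part (lsubmx z) (rsubmx z) w) (row_mx x t)
    (fun v => vertical_part_deriv x t v w).
Proof.
move=> Ux; set z0 := row_mx x t.
have lz0 : lsubmx z0 = x by rewrite row_mxKl.
have rz0 : rsubmx z0 = t by rewrite row_mxKr.
have Uz0 : U (lsubmx z0) by rewrite lz0.
have dact := mdiff_tensor_action (p := p) (q := q)
  (mdiff_conn_form U_open G_smooth G_sym G_unit
  Uz0 (is_diff_lsubmx z0) (mdiff_cst (lsubmx w) z0)).
have dvert := mdiffD (mdiff_cst (rsubmx w) z0)
  (mdiffN (mdiff_mul (is_diff_mdiff (is_diff_rsubmx z0)) dact)).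
apply: mdiff_ext dvert => v; rewrite lz0 rz0 add0r; congr (- (_ + _)).
by rewrite conn_form0 addr0.
Qed.

(** The derivative of S(w, u) in the direction v, for constant w and u. The
    derivatives of g and of the fibre metric have been moved to the arguments by
    parallelism, so that only metrics at the point itself occur. *)
Definition sasaki_deriv x t v w u : R :=
  'd f x (lsubmx v) * dot (G x) (lsubmx w) (lsubmx u)
  + f x * (dot (G x) (lsubmx w *m (conn_form G x (lsubmx v))^T) (lsubmx u)
           + dot (G x) (lsubmx w) (lsubmx u *m (conn_form G x (lsubmx v))^T))
  + dot (H x) (vertical_part_deriv x t v w) (vertical_part x t u)
  + dot (H x) (vertical_part x t w) (vertical_part_deriv x t v u)
  - dot (H x) (vertical_part x t w *m act x (lsubmx v)) (vertical_part x t u)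
  - dot (H x) (vertical_part x t w) (vertical_part x t u *m act x (lsubmx v)).

Lemma is_diff_sasaki x t w u : U x ->
  is_diff (row_mx x t) (fun z => dot (S z) w u)
    (fun v => sasaki_deriv x t v w u).
Proof.
move=> Ux; set z0 := row_mx x t.
have lz0 : lsubmx z0 = x by rewrite row_mxKl.
have rz0 : rsubmx z0 = t by rewrite row_mxKr.
have Uz0 : U (lsubmx z0) by rewrite lz0.
have dl := is_diff_lsubmx z0.
have df := is_diff_comp dl (differentiableP (f_diff Uz0)).
have dG := mdiff_comp dl (mdiff_metric U_open G_smooth G_sym G_unit Uz0).
have dH := mdiff_comp dl (mdiff_fibre_metric (p := p) (q := q) U_open G_smooth G_sym G_unit Uz0).
have dlin := is_diff_mul df
  (is_diff_dot dG (mdiff_cst (lsubmx w) z0) (mdiff_cst (lsubmx u) z0)).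
have dvert := is_diff_dot dH (mdiff_vertical_part t w Ux)
  (mdiff_vertical_part t u Ux).
have lc : {for z0, continuous (lsubmx : 'rV[R]_(n + _) -> 'rV[R]_n)}.
  exact/differentiable_continuous/differentiable_lsubmx.
have U_near : \forall z \near z0, U (lsubmx z).
  by apply: (lc U); rewrite lz0; apply: open_nbhs_nbhs.
suff dform : is_diff z0 (fun z => f (lsubmx z) *
      dot (G (lsubmx z)) (lsubmx w) (lsubmx u) +
    dot (H (lsubmx z)) (vertical_part (lsubmx z) (rsubmx z) w)
      (vertical_part (lsubmx z) (rsubmx z) u))
    (fun v => sasaki_deriv x t v w u).
  apply: is_diff_near dform; apply: filterS U_near => z Uz.
  by rewrite -[in RHS](hsubmxK z) S_dot.
apply: (is_diff_ext (is_diffD dlin dvert)) => // v.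
rewrite !fctE /= lz0 rz0 !dot0l !dot0r !addr0.
rewrite !(dot_addmx, dot_oppmx) !(dot_mulmxl _ (G x)) !(dot_mulmxl _ (H x)).
rewrite !(dot_mulmxr _ (G x)) !(dot_mulmxr _ (H x)) trmxK /sasaki_deriv.
rewrite opprD !addrA.
repeat match goal with |- context [dot ?A ?a ?b] => move: (dot A a b) => ? end.
by ring.
Qed.

Lemma sasaki_euler_lagrange x t v (acc : 'rV[R]_(n + #|multi n p q|)) : U x ->
  (forall a, acc 0 a + \sum_i \sum_j
     christoffel S (row_mx x t) a i j * v 0 i * v 0 j = 0) ->
  forall w, dot (S (row_mx x t)) w acc + sasaki_deriv x t v w v
            - 2^-1 * sasaki_deriv x t w v v = 0.
Proof.
move=> Ux geod w; set z0 := row_mx x t.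
have S_entry_diff a b : differentiable (fun z => S z a b) z0.
  apply: is_diff_differentiable.
  apply: (is_diff_ext (is_diff_sasaki t (delta_mx 0 a) (delta_mx 0 b) Ux)) => //.
  by move=> z; rewrite dot_delta.
have dSz := mdiff_exists S_entry_diff; set dS := (fun=> _) in dSz.
have dS_dot u w1 w2 : dot (dS u) w1 w2 = sasaki_deriv x t u w1 w2.
  have dd := is_diff_dot dSz (mdiff_cst w1 z0) (mdiff_cst w2 z0).
  have := congr1 (@^~ u) (is_diff_unique dd (is_diff_sasaki t w1 w2 Ux)).
  by rewrite dot0l dot0r !addr0.
have := geodesic_euler_lagrange (sasaki_unit t Ux) dSz geod w.
by rewrite -!/(dot _ _ _) !dS_dot.
Qed.

(** One instant of a geodesic: (X, V) is its velocity and (X', V') its second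
    derivative in the induced coordinates. *)
Section Geodesic.
Context {x X X' : 'rV[R]_n} {t V V' : tensor R n p q}.
Hypothesis Ux : U x.
Hypothesis geodesic : forall a, row_mx X' V' 0 a + \sum_i \sum_j
  christoffel S (row_mx x t) a i j * row_mx X V 0 i * row_mx X V 0 j = 0.

Local Notation T := (V - t *m act x X).

Let vertical_partE (Y : 'rV[R]_n) (A : tensor R n p q) :
  vertical_part x t (row_mx Y A) = A - t *m act x Y.
Proof. by rewrite /vertical_part row_mxKl row_mxKr. Qed.

Let vertical_part_derivE (Z Y : 'rV[R]_n) (C A : tensor R n p q) :
  vertical_part_deriv x t (row_mx Z C) (row_mx Y A) =
  - (C *m act x Y + t *m act' x Z Y).
Proof. by rewrite /vertical_part_deriv !row_mxKl row_mxKr. Qed.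

(** The left-hand side is the coordinate derivative of the vertical part T of
    the velocity, so that testing with vertical vectors shows T to be parallel. *)
Lemma vertical_equation :
  V' - t *m act x X' - (V *m act x X + t *m act' x X X) = T *m act x X.
Proof.
apply/eqP; rewrite -subr_eq0; apply/eqP.
have Hu : H x \in unitmx by apply: fibre_metric_unit; exact: G_unit.
have Hs : (H x)^T = H x by apply: fibre_metric_sym; exact: G_sym.
apply: (dot_nondeg Hu) => A.
have := sasaki_euler_lagrange Ux geodesic (row_mx 0 A).
rewrite S_dot // /sasaki_deriv !vertical_partE !vertical_part_derivE !row_mxKl.
rewrite conn_form0 conn_form_deriv0l conn_form_deriv0r linear0 tensor_action0.
rewrite !(mul0mx, mulmx0, trmx0, dot0l, dot0r, mulr0, mul0r, oppr0, addr0, add0r,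
  subr0).
rewrite !dotNl !dotNr (dotC T (A *m _)) //.
rewrite !(dotDr _ A) !dotNr !(dotDr _ A) => <-.
repeat match goal with |- context [dot ?B ?a ?b] => move: (dot B a b) => ? end.
by field.
Qed.

(** Against the horizontal lift of W the second derivative of the fibre
    coordinates drops out. Of the terms containing T, those quadratic in T cancel
    and the others assemble into the curvature acting on t, by the structure
    equation. *)
Lemma horizontal_equation W :
  f x * dot (G x) W (X' + X *m (conn_form G x X)^T)
  + 'd f x X * dot (G x) W X - 2^-1 * ('d f x W * dot (G x) X X)
  + dot (H x) (t *m tensor_action p q
      (\matrix_(s, j) \sum_k \sum_l W 0 k * X 0 l * riemann G x k l j s)) T = 0.
Proof.
have Gs := G_sym Ux.
have Hs : (H x)^T = H x by apply: fibre_metric_sym.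
have := sasaki_euler_lagrange Ux geodesic (row_mx W (t *m act x W)).
rewrite S_dot // /sasaki_deriv !vertical_partE !vertical_part_derivE !row_mxKl.
rewrite (conn_form_sym U_open G_sym G_unit X W Ux).
rewrite subrr !(mul0mx, dot0l, dot0r, mulr0, addr0, subr0).
rewrite (dotC X (W *m _)) //.
(* Splitting V into T and its horizontal part isolates the terms quadratic in T. *)
have -> : V *m act x W = T *m act x W + t *m act x X *m act x W.
  by rewrite -mulmxDl subrK.
rewrite -(riemannE U_open G_smooth G_sym G_unit W X Ux) tensor_actionD.
rewrite -tensor_action_commutator tensor_actionD tensor_actionN.
rewrite !(mulmxDr, mulmxN, mulmxA).
move: (V - _) => T0; rewrite !(dotC T0) //.
rewrite !(dotDl, dotNl) !dotDr => <-.
repeat match goal with |- context [dot ?B ?a ?b] => move: (dot B a b) => ? end.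
by field.
Qed.

End Geodesic.

End SasakiMetric.

(** * The equations in index notation *)

Section Curves.
Context {R : realType} {N : nat}.
Implicit Types (c : R -> 'rV[R]_N) (t : R).

Definition velocity_row c t : 'rV[R]_N := \row_a velocity c t a.

Definition second_derivative_row c t : 'rV[R]_N :=
  \row_a derive1n 2 (fun s => c s 0 a) t.

Lemma is_diff_derive1 (f : R -> R) t :
  derivable f t 1 -> is_diff t f (fun h => h * derive1 f t).
Proof.
move=> df; apply: DiffDef; first exact/derivable1_diffP.
by rewrite deriv1E.
Qed.

Lemma is_diff_curve c t :
  (forall a, derivable (fun s => c s 0 a) t 1) ->
  is_diff t c (fun h => h *: velocity_row c t).
Proof.
move=> dc; have dct : derivable c t 1.
  by apply/derivable_mxP => i a; rewrite (ord1 i); exact: dc.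
apply: DiffDef; first exact/derivable1_diffP.
rewrite deriv1E //; apply/funext => h; congr (_ *: _).
rewrite derive1E derive_mx //; apply/rowP => a; rewrite !mxE /velocity.
by rewrite derive1E.
Qed.

Lemma mdiff_velocity_row c t :
  (forall a, derivable (derive1n 1 (fun s => c s 0 a)) t 1) ->
  mdiff (velocity_row c) t (fun h => h *: second_derivative_row c t).
Proof.
move=> dc i a; apply: (is_diff_ext (is_diff_derive1 (dc a))) => s.
  by rewrite (ord1 i) mxE.
by rewrite (ord1 i) !mxE.
Qed.

Lemma velocity_row_mdiff c t dc : mdiff c t dc -> velocity_row c t = dc 1.
Proof.
move=> dct; apply/rowP => a; rewrite mxE /velocity.
have [dca dcaE] := dct 0 a.
by rewrite derive1E' //; exact: (congr1 (@^~ 1) dcaE).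
Qed.

End Curves.

Section CovariantDerivative.
Context {R : realType} {n p q : nat}.
Context {U : set 'rV[R]_n} {G : 'rV[R]_n -> 'M[R]_n}.
Hypotheses (U_open : open U) (G_smooth : forall a b, smooth_on U (fun x => G x a b)).
Hypotheses (G_sym : forall x, U x -> (G x)^T = G x).
Hypothesis (G_unit : forall x, U x -> G x \in unitmx).
Implicit Types (x : R -> 'rV[R]_n) (tau : R -> tensor R n p q).

Lemma cov_derivE x tau s :
  cov_deriv G x tau s = velocity_row tau s -
    tau s *m tensor_action p q (conn_form G (x s) (velocity_row x s)).
Proof.
apply/rowP => a; rewrite -[a]enum_valK; case: (enum_val a) => i j.
rewrite mxE enum_rankK /= [RHS]mxE [in RHS]mxE; congr (_ + _).
rewrite [RHS]mxE -[X in _ = - X]/(tcomp _ i j) tensor_action_conn_form -sumrN.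
by apply: eq_bigr => l _; rewrite mxE -mulrN opprB.
Qed.

Lemma mdiff_cov_deriv x tau s : U (x s) ->
  (forall a, derivable (fun s' => x s' 0 a) s 1) ->
  (forall a, derivable (derive1n 1 (fun s' => x s' 0 a)) s 1) ->
  (forall a, derivable (fun s' => tau s' 0 a) s 1) ->
  (forall a, derivable (derive1n 1 (fun s' => tau s' 0 a)) s 1) ->
  mdiff (cov_deriv G x tau) s (fun h => h *: second_derivative_row tau s -
    ((h *: velocity_row tau s) *m
       tensor_action p q (conn_form G (x s) (velocity_row x s)) +
     tau s *m tensor_action p q
       (conn_form_deriv G (x s) (h *: velocity_row x s) (velocity_row x s) +
        conn_form G (x s) (h *: second_derivative_row x s)))).
Proof.
move=> Us dx ddx dtau ddtau.
have dact := mdiff_tensor_action (p := p) (q := q) (mdiff_conn_form U_open G_smooth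
  G_sym G_unit Us (is_diff_curve dx) (mdiff_velocity_row ddx)).
have dT := mdiffD (mdiff_velocity_row ddtau)
  (mdiffN (mdiff_mul (is_diff_mdiff (is_diff_curve dtau)) dact)).
apply: mdiff_near dT; near=> s'; exact/esym/cov_derivE.
Unshelve. all: by end_near. Qed.

End CovariantDerivative.

Section RaisingTheIndex.
Context {R : realType} {n p q : nat}.
Implicit Types (G : 'rV[R]_n -> 'M[R]_n) (x X : 'rV[R]_n).

Lemma dot_row_inv (A : 'M[R]_n) (r : 'I_n) (a : 'rV[R]_n) :
  A \in unitmx -> dot A (row r (invmx A)) a = a 0 r.
Proof.
by move=> Au; rewrite /dot -row_mul mulVmx // row1 -rowE !mxE.
Qed.

Lemma accelerationE G (x : R -> 'rV[R]_n) t r :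
  acceleration G x t r = (second_derivative_row x t +
    velocity_row x t *m (conn_form G (x t) (velocity_row x t))^T) 0 r.
Proof.
rewrite !mxE; congr (_ + _); rewrite exchange_big; apply: eq_bigr => j _ /=.
rewrite !mxE mulr_sumr; apply: eq_bigr => i _.
by rewrite !mxE mulrC; congr (_ * _); rewrite mulrC.
Qed.

Lemma fA_contract G (f : 'rV[R]_n -> R) x X r : differentiable f x ->
  \sum_l \sum_j fA G f x r l j * X 0 l * X 0 j =
  2 * ('d f x X * X 0 r) - 'd f x (row r (invmx (G x))) * dot (G x) X X.
Proof.
move=> df; rewrite !diff_partial // /dot quad_formE.
under [X in _ - X * _]eq_bigr do rewrite mxE.
set fr := \sum_m invmx (G x) r m * _.
have term1 : \sum_l \sum_j partial l f x * (r == j)%:R * X 0 l * X 0 j =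
    (\sum_k X 0 k * partial k f x) * X 0 r.
  rewrite mulr_suml; apply: eq_bigr => l _.
  rewrite (bigD1 r) //= eqxx [X in _ + X]big1.
    by rewrite addr0 mulr1 [partial l f x * _]mulrC.
  by move=> j; rewrite eq_sym => /negbTE ->; rewrite mulr0 !mul0r.
have term2 : \sum_l \sum_j partial j f x * (r == l)%:R * X 0 l * X 0 j =
    (\sum_k X 0 k * partial k f x) * X 0 r.
  by rewrite exchange_big -term1; apply: eq_bigr => l _; apply: eq_bigr => j _; ring.
rewrite mulr2n mulrDl mul1r -[X in _ = X + _ - _]term1 -[X in _ + X - _]term2.
rewrite mulr_sumr -big_split -sumrB; apply: eq_bigr => l _ /=.
rewrite mulr_sumr -big_split -sumrB; apply: eq_bigr => j _ /=.
by rewrite /fA -/fr; ring.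
Qed.

(** The r-th row of the inverse metric raises the first index of the curvature. *)
Lemma curvature_contract G x X (t T : tensor R n p q) r : (G x)^T = G x ->
  dot (fibre_metric p q (G x)) (t *m tensor_action p q
    (\matrix_(s, j) \sum_k \sum_l
       row r (invmx (G x)) 0 k * X 0 l * riemann G x k l j s)) T =
  \sum_(a : {ffun 'I_p -> 'I_n}) \sum_(k : {ffun 'I_p -> 'I_n})
  \sum_(l : {ffun 'I_q -> 'I_n}) \sum_(h : {ffun 'I_q -> 'I_n}) \sum_(j < n)
    lower_prod (G x) a k * lower_prod (invmx (G x)) l h *
    (\sum_(mu < q) \sum_s riemann_up G x r j (h mu) s *
                          tcomp t k (subst_index h mu s)
     - \sum_(la < p) \sum_s riemann_up G x r j s (k la) *
                            tcomp t (subst_index k la s) h) *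
    tcomp T a l * X 0 j.
Proof.
move=> Gs; rewrite dotC; last exact: fibre_metric_sym.
rewrite /dot -fibre_productE /fibre_product.
apply: eq_bigr => a _; apply: eq_bigr => k _; apply: eq_bigr => l _.
apply: eq_bigr => h _.
have invs i j : invmx (G x) i j = invmx (G x) j i.
  by rewrite -[in LHS]Gs -trmx_inv mxE.
rewrite (_ : \matrix_(s, j) _ = \matrix_(s, j) \sum_l0 X 0 l0 *
    (\matrix_(a, b) riemann_up G x r l0 b a) s j); last first.
  apply/matrixP => s j; rewrite !mxE exchange_big; apply: eq_bigr => l0 _ /=.
  rewrite mxE mulr_sumr; apply: eq_bigr => m _.
  by rewrite mxE invs mulrAC mulrC.
rewrite tensor_action_contract mulr_sumr; apply: eq_bigr => j _.
rewrite -[RHS]mulrA -[RHS]mulrA -[LHS]mulrA; congr (_ * _).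
rewrite [LHS]mulrA [RHS]mulrC; congr (_ * (_ - _));
  by apply: eq_bigr => m _; apply: eq_bigr => s _; rewrite mxE.
Qed.

End RaisingTheIndex.

Section Charts.
Context {R : realType} {n p q : nat} {M : manifold R n}.
Implicit Types (g : riemannian_metric M) (f : M -> R) (i : chart_index M).

Lemma metric_unit g i x : chart_image i x -> g i x \in unitmx.
Proof.
move=> xi; rewrite -row_free_unit; apply: inj_row_free => v vG0.
apply/eqP; apply: contraT => v0; have := metric_pos g xi v0.
by rewrite vG0 mul0mx mxE ltxx.
Qed.

Lemma sasaki_dot g f Sg (hSg : @is_rescaled_sasaki R n M p q g f Sg) i x t w u :
  chart_image i x ->
  dot (Sg i (row_mx x t)) w u =
    local_fun f i x * dot (g i x) (lsubmx w) (lsubmx u) +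
    dot (fibre_metric p q (g i x)) (vertical_part (G := g i) x t w)
      (vertical_part (G := g i) x t u).
Proof.
move=> xi.
(* Every vector is a horizontal lift plus the vertical lift of its vertical part,
   and on such lifts the metric is prescribed. *)
have liftE z : z = horizontal_lift (g i) x t (lsubmx z) +
    vertical_lift (vertical_part (G := g i) x t z).
  rewrite horizontal_liftE /vertical_lift add_row_mx addr0 /vertical_part.
  by rewrite [X in row_mx _ X]addrC subrK hsubmxK.
have S_sym := sasaki_sym hSg t xi.
rewrite {1}(liftE w) {1}(liftE u) [LHS]dotDl.
rewrite [X in X + _ = _]dotDr [X in _ + X = _]dotDr.
rewrite [dot _ (horizontal_lift _ _ _ _) (vertical_lift _)]dotC //.
rewrite /dot (sasaki_HH hSg) // !(sasaki_VH hSg) // (sasaki_VV hSg) //.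
by rewrite fibre_productE addr0 add0r.
Qed.

End Charts.

Unset Implicit Arguments.

Theorem theorem12 (R : realType) (n p q : nat) (M : manifold R n)
  (g : riemannian_metric M) (f : M -> R)
  (hf : smooth_fun f) (f_gt0 : forall m : M, 0 < f m)
  (Sg : chart_index M ->
        'rV[R]_(n + #|multi n p q|) -> 'M[R]_(n + #|multi n p q|))
  (hSg : is_rescaled_sasaki g f Sg)
  (J : set R) (J_open : open J) (J_itv : is_interval J)
  (c : R -> tensor_bundle M p q) (hc : is_geodesic Sg J c)
  (i : chart_index M) (t : R) (Jt : J t)
  (it : chart_dom (atlas i) (base (c t))) :
  let x := local_base i c in
  let tau := local_tensor i c in
  let f' := local_fun f i in
  let g' := g i (x t) in
  (forall r : 'I_n,
     acceleration (g i) x t r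
     + (2 * f' (x t))^-1 * (\sum_l \sum_j
         fA (g i) f' (x t) r l j * velocity x t l * velocity x t j)
     + (f' (x t))^-1 * (\sum_(a : {ffun 'I_p -> 'I_n})
         \sum_(k : {ffun 'I_p -> 'I_n}) \sum_(l : {ffun 'I_q -> 'I_n})
         \sum_(h : {ffun 'I_q -> 'I_n}) \sum_(j < n)
           lower_prod g' a k * lower_prod (invmx g') l h *
           (\sum_(mu < q) \sum_s riemann_up (g i) (x t) r j (h mu) s *
                                 tcomp (tau t) k (subst_index h mu s)
            - \sum_(la < p) \sum_s riemann_up (g i) (x t) r j s (k la) *
                                   tcomp (tau t) (subst_index k la s) h) *
           tcomp (cov_deriv (g i) x tau t) a l * velocity x t j)
     = 0)
  /\
  (forall (v : {ffun 'I_p -> 'I_n}) (r : {ffun 'I_q -> 'I_n}),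
     tcomp (cov_deriv (g i) x (cov_deriv (g i) x tau) t) v r = 0).
Proof.
move=> x tau f' g'.
pose z := local_curve i c.
have [_ z_smooth z_geod] := hc.
have zs k a : derivable (derive1n k (fun s => z s 0 a)) t 1.
  exact: z_smooth i k a t (conj Jt it).
have xE a : (fun s => x s 0 a) = (fun s => z s 0 (lshift _ a)).
  by apply/funext => s; rewrite /z /local_curve row_mxEl.
have tauE a : (fun s => tau s 0 a) = (fun s => z s 0 (rshift _ a)).
  by apply/funext => s; rewrite /z /local_curve row_mxEr.
have xs k a : derivable (derive1n k (fun s => x s 0 a)) t 1 by rewrite xE.
have taus k a : derivable (derive1n k (fun s => tau s 0 a)) t 1 by rewrite tauE.
have U_open : open (chart_image i) by exact: chart_image_open.
have Ux : chart_image i (x t) by exists (base (c t)).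
have G_smooth := metric_smooth g i.
have G_sym y : chart_image i y -> (g i y)^T = g i y := @Defs.metric_sym _ _ _ g i y.
have G_unit y : chart_image i y -> g i y \in unitmx := @metric_unit _ _ _ g i y.
have f_diff y : chart_image i y -> differentiable f' y.
  by have [fd _] := hf i 1%N; exact: fd.
have f_pos y : chart_image i y -> 0 < f' y by move=> _; exact: f_gt0.
have S_dot y s w u := @sasaki_dot _ _ p q _ g f Sg hSg i y s w u.
(* The geodesic equation, with the base and fibre coordinates separated. *)
have geod a : row_mx (second_derivative_row x t) (second_derivative_row tau t) 0 a
    + \sum_k \sum_j christoffel (Sg i) (row_mx (x t) (tau t)) a k j *
      row_mx (velocity_row x t) (velocity_row tau t) 0 k *
      row_mx (velocity_row x t) (velocity_row tau t) 0 j = 0.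
  have velE b : row_mx (velocity_row x t) (velocity_row tau t) 0 b = velocity z t b.
    by case: (split_ordP b) => b' ->;
      rewrite ?row_mxEl ?row_mxEr mxE /velocity ?xE ?tauE.
  rewrite -[RHS](z_geod i t (conj Jt it) a) /acceleration; congr (_ + _); last first.
    by apply: eq_bigr => k _; apply: eq_bigr => j _; rewrite !velE.
  by case: (split_ordP a) => a' ->; rewrite ?row_mxEl ?row_mxEr mxE ?xE ?tauE.
have vert := vertical_equation U_open G_smooth G_sym G_unit f_diff f_pos S_dot Ux geod.
have horiz := horizontal_equation U_open G_smooth G_sym G_unit f_diff f_pos S_dot
  Ux geod.
have velocityE : velocity x t = velocity_row x t 0.
  by apply/funext => j; rewrite mxE.
split=> [r|v r].
  have divide a d e C : f' (x t) * a + d - 2^-1 * e + C = 0 ->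
      a + (2 * f' (x t))^-1 * (2 * d - e) + (f' (x t))^-1 * C = 0.
    have : f' (x t) != 0 by rewrite gt_eqF // f_pos.
    move: (f' (x t)) => F F0 E.
    have -> : C = 2^-1 * e - d - F * a.
      by apply/eqP; rewrite -subr_eq0 -E; apply/eqP; ring.
    by field.
  have := horiz (row r (invmx g')).
  rewrite !dot_row_inv ?G_unit // -accelerationE.
  rewrite curvature_contract ?G_sym // -cov_derivE velocityE -/g'.
  rewrite (fA_contract (g i) (velocity_row x t) r (f_diff _ Ux)) -/g'.
  exact: divide.
(* The derivative of delta t / dt as a function of the parameter is the left-hand
   side of the vertical equation. *)
have dT := mdiff_cov_deriv U_open G_smooth G_sym G_unit (tau := tau) Ux (xs 0%N)
  (xs 1%N) (taus 0%N) (taus 1%N).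
rewrite cov_derivE (velocity_row_mdiff dT) !scale1r tensor_actionD mulmxDr.
rewrite cov_derivE -vert addrA opprD addrA [X in X - _]addrAC subrr.
by rewrite /tcomp mxE.
Qed.
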